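(* Let $(W_k)_{k\ge 0}$ be the simple random walk on the $2$-dimensional comb $\mathbb{C}^2$ started at $W_0=(0,0)$, and for $n\ge 1$ let $V_n=|\{W_0,W_1,\dots,W_n\}|$ be the number of distinct vertices visited during the first $n$ steps. Then, as $n\to\infty$, $$E[V_n]=\left(\frac{1}{2\sqrt{2\pi}}+o(1)\right)\sqrt{n}\,\log n.$$
   Context: The $2$-dimensional comb $\mathbb{C}^2$ is the graph with vertex set $\mathbb{Z}\times\mathbb{Z}$ obtained from the integer grid (where two points are adjacent iff they are at Euclidean distance $1$) by removing all horizontal edges (edges parallel to the $x$-axis) that do not lie on the $x$-axis. Thus every vertex $(x,y)$ with $y\neq 0$ has degree $2$, with neighbors $(x,y\pm 1)$, and every vertex $(x,0)$ has degree $4$, with neighbors $(x\pm1,0)$ and $(x,\pm1)$. The simple random walk on a locally finite graph moves, at each step, from its current vertex $v$ to one of the neighbors of $v$, each chosen with probability $1/d(v)$, where $d(v)$ is the degree of $v$, independently of all previous events. $\log$ denotes the natural logarithm. *)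

(* Defs.v *)
From HB Require Import structures.
From mathcomp Require Import all_boot all_order all_algebra finmap.
From mathcomp Require Import all_classical all_reals all_analysis.

Set Implicit Arguments.
Unset Strict Implicit.
Unset Printing Implicit Defensive.

Import Order.TTheory GRing.Theory Num.Theory.
Import numFieldNormedType.Exports.

Local Open Scope classical_set_scope.
Local Open Scope ring_scope.

(* Meaningful only for locally finite graphs: the value is 0 on a vertex with
   infinitely many neighbours. *)
Definition degree (V : choiceType) (adj : rel V) (v : V) : nat :=
  #|` fset_set [set w | adj v w]|.

Definition step_prob (R : realType) (V : choiceType) (adj : rel V) (v w : V) : R :=
  if adj v w then (degree adj v)%:R^-1 else 0.

(* [W k] is the position at time [k]. The state space [V] is meant to be
   countable and carries the discrete sigma-algebra; no measurable structure is
   declared on it, so measurability of [W k] is stated through preimages.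
   [srw_step] says that, whatever the trajectory [v 0, ..., v n] up to time [n],
   the next vertex is chosen uniformly among the neighbours of [v n]; the product
   form also covers trajectories of probability zero. *)
Record simple_random_walk (d : measure_display) (T : measurableType d)
    (R : realType) (P : probability T R) (V : choiceType) (adj : rel V) (o : V)
    (W : nat -> T -> V) : Prop := SimpleRandomWalk {
  srw_measurable : forall (k : nat) (A : set V), measurable (W k @^-1` A);
  srw_start : P (W 0%N @^-1` [set o]) = 1%E;
  srw_step : forall (n : nat) (v : nat -> V) (w : V),
    P [set t | (forall k, (k <= n)%N -> W k t = v k) /\ W n.+1 t = w] =
    (P [set t | forall k, (k <= n)%N -> W k t = v k]
      * (step_prob R adj (v n) w)%:E)%E }.

Definition visited (T : Type) (V : choiceType) (W : nat -> T -> V) (n : nat) (t : T) : nat :=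
  size (undup [seq W k t | k <- iota 0 n.+1]).

(* For integer points, Euclidean distance 1 is the same as squared distance 1. *)
Definition grid_adj : rel (int * int) :=
  fun u v => (u.1 - v.1) ^+ 2 + (u.2 - v.2) ^+ 2 == 1.

Definition comb_adj : rel (int * int) :=
  fun u v => grid_adj u v && ~~ ((u.2 == v.2) && (u.2 != 0)).

(* Main.v *)
(* Let [p k] be the probability that the vertex visited at time [k] is new, so
   that [E V_n] is the sum of [p k] over [k <= n]. With [z], [a], [l] linked by
   [z = 2 a / (1 + a^2)] and [a = 2 l / (1 + l^2)], the first-step equations are
   solved explicitly: the generating function in [z] of the first hitting time of
   [(x, y)] from the origin is [l^|x| h(|y|)], where [h = tooth_hit l]. Summing
   over all vertices, the generating function of [p k] is
   [(1 + l) / (1 - l) * (1 + 2 (h 1 + h 2 + ...))]. As [l] tends to 1,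
   [h 1 + h 2 + ...] behaves like [ln (1 / (1 - l)) / (2 (1 - l))], because [h y]
   is close to [1 / (2 (1 - l) y)] between the scales [1 / (1 - l)] and
   [1 / (1 - l)^2], while [(1 - l)^4] is equivalent to [8 (1 - z)].
   A Tauberian argument for the nonnegative sequence [p k] concludes; its constant
   is obtained by comparison with the indicator of the squares, whose generating
   function is a Riemann sum of the Gaussian integral and whose partial sums are
   square roots, so that no Gamma function appears. *)
Require Import Defs.
From HB Require Import structures.
From mathcomp Require Import all_boot all_order all_algebra finmap.
From mathcomp Require Import all_classical all_reals all_analysis.
From mathcomp Require Import measurable_realfun ring lra zify.
Set Implicit Arguments.
Unset Strict Implicit.
Unset Printing Implicit Defensive.
Import Order.TTheory GRing.Theory Num.Theory.
Import numFieldNormedType.Exports.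
Local Open Scope classical_set_scope.
Local Open Scope ring_scope.

(** * Karamata's Tauberian argument *)

(** As a function of the starting height, a hitting generating function on a tooth solves
    [f y = z (f (y+1) + f (y-1)) / 2], whose characteristic roots are [a] and [1/a] with
    [2/z = a + 1/a]. On the spine, away from the target column, both vertical neighbours of a foot
    contribute a factor [a], so the horizontal ratio satisfies [4/z = l + 1/l + 2 a], that is
    [2/a = l + 1/l]: the same relation once more. Parametrising by [l] removes the nested square
    roots, and the first-step equations become rational identities. The solution may then be
    guessed, because a bounded solution is unique. At [z = e^(-t)] the series of the [p k] is
    equivalent to [ln (1/t) / (2 sqrt (8 t))] and that of the squares to [(sqrt pi / 2) / sqrt t];
    the quotient of the constants is [1 / (2 sqrt (2 pi))]. The logarithm does not disturb the
    comparison, since [ln (n/m) / ln n] tends to 1 for each fixed [m]. *)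

Section Step.
Variable R : realType.
Implicit Types (x y a b q e eta : R).

Lemma expr_le_eventually q e : 0 <= q < 1 -> 0 < e -> \forall n \near \oo, q ^+ n <= e.
Proof.
move=> /andP[q0 q1] e0.
have /cvgrPdist_le /(_ e e0) : (q ^+ n @[n --> \oo] --> (0 : R)).
  by apply: cvg_expr; rewrite ger0_norm.
apply: filterS => n; rewrite sub0r normrN ger0_norm //; exact: exprn_ge0.
Qed.

Lemma expr_1D_ge y n : 0 <= y -> 1 + n%:R * y <= (1 + y) ^+ n.
Proof.
move=> y0; elim: n => [|n IH]; first by rewrite mul0r addr0 expr0.
rewrite exprS; apply: (@le_trans _ _ ((1 + y) * (1 + n%:R * y))).
  rewrite mulrDl mul1r mulrDr mulr1 -natr1 mulrDl mul1r.
  have : 0 <= y * (n%:R * y) by rewrite mulr_ge0 // mulr_ge0.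
  lra.
by rewrite ler_wpM2l //; lra.
Qed.

Lemma expr_1B_ge y n : 0 <= y <= 1 -> 1 - n%:R * y <= (1 - y) ^+ n.
Proof.
move=> /andP[y0 y1]; elim: n => [|n IH]; first by rewrite mul0r subr0 expr0.
rewrite exprS; apply: (@le_trans _ _ ((1 - y) * (1 - n%:R * y))).
  rewrite mulrBl mul1r mulrBr mulr1 -natr1 mulrDl mul1r.
  have : 0 <= y * (n%:R * y) by rewrite mulr_ge0 // mulr_ge0.
  lra.
by rewrite ler_wpM2l //; lra.
Qed.

(* With [c] strictly between [a] and [b], [1 - (1 - x^m)^(c^-m)] is nearly a
   step at [c] when [m] is large. *)
Lemma step_poly a b eta : 0 < a -> a < b -> b <= 1 -> 0 < eta ->
  exists p : {poly R}, [/\ p.[0] = 0,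
    forall x, 0 <= x <= 1 -> 0 <= p.[x] <= 1,
    forall x, 0 <= x <= a -> p.[x] <= eta * x &
    forall x, b <= x <= 1 -> 1 - eta * x <= p.[x] ].
Proof.
move=> a0 ab b1 e0.
set c := (a + b) / 2.
have c0 : 0 < c by rewrite /c; lra.
have ac : a < c by rewrite /c; lra.
have cb : c < b by rewrite /c; lra.
have b0 : 0 < b by lra.
clearbody c.
(* Only the [m]-th powers are made small while the polynomial uses [m.+1]: the spare factor [x / c]
   turns the error below [a] into a multiple of [x]. *)
have [m [Hm1 Hm2]] : exists m, (a / c) ^+ m <= eta * c /\ (c / b) ^+ m <= eta * b.
  have h1 : 0 <= a / c < 1.
    by rewrite divr_ge0 ?(ltW a0) ?(ltW c0) //= ltr_pdivrMr // mul1r.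
  have h2 : 0 <= c / b < 1.
    by rewrite divr_ge0 ?(ltW b0) ?(ltW c0) //= ltr_pdivrMr // mul1r.
  have H1 := expr_le_eventually h1 (mulr_gt0 e0 c0).
  have H2 := expr_le_eventually h2 (mulr_gt0 e0 b0).
  have [N _ HN] : \forall n \near \oo, (a / c) ^+ n <= eta * c /\ (c / b) ^+ n <= eta * b.
    by near=> n; split; near: n.
  by exists N; apply: HN => /=.
set M := Num.truncn (c ^- m.+1).
have cm0 : 0 <= c ^- m.+1 by rewrite invr_ge0 exprn_ge0 // ltW.
have /andP[M1 M2] := truncn_itv cm0; rewrite -/M in M1 M2.
exists (1 - (1 - 'X^(m.+1)) ^+ M).
have pE x : (1 - (1 - 'X^(m.+1)) ^+ M : {poly R}).[x] = 1 - (1 - x ^+ m.+1) ^+ M.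
  by rewrite !(hornerE, horner_exp).
have xm x : 0 <= x <= 1 -> 0 <= x ^+ m.+1 <= 1.
  by move=> /andP[x0 x1]; rewrite exprn_ge0 //= exprn_ile1.
split.
- by rewrite pE expr0n /= subr0 expr1n subrr.
- move=> x /xm /andP[x0 x1]; rewrite pE.
  have : 0 <= (1 - x ^+ m.+1) ^+ M <= 1.
    by rewrite exprn_ge0 /= ?exprn_ile1 //; lra.
  lra.
- move=> x /andP[x0 xa]; rewrite pE.
  have x1 : 0 <= x <= 1 by apply/andP; split => //; lra.
  have := expr_1B_ge M (xm _ x1).
  suff : M%:R * x ^+ m.+1 <= eta * x by rewrite -/M; lra.
  apply: (@le_trans _ _ (c ^- m.+1 * x ^+ m.+1)).
    by rewrite ler_wpM2r // exprn_ge0.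
  rewrite mulrC -expr_div_n exprS.
  apply: (@le_trans _ _ ((x / c) * (eta * c))).
    rewrite ler_wpM2l //; first by rewrite divr_ge0 // ltW.
    apply: le_trans Hm1; apply: lerXn2r; rewrite ?nnegrE ?divr_ge0 ?(ltW c0) ?(ltW a0) //.
    by rewrite ler_pM2r ?invr_gt0.
  by rewrite mulrCA divfK // gt_eqF.
- move=> x /andP[bx x1]; rewrite pE.
  have x0 : 0 <= x by lra.
  have x01 : 0 <= x <= 1 by rewrite x0.
  have /andP[y0 y1] := xm _ x01.
  set y := x ^+ m.+1 in y0 y1 *.
  suff : (1 - y) ^+ M <= eta * x by lra.
  (* An upper bound on [(1 - y) ^+ M] follows from a lower bound on [(1 + y) ^+ M], which
     Bernoulli's inequality provides. *)
  have Q : (1 - y) ^+ M * (1 + y) ^+ M <= 1.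
    rewrite -exprMn exprn_ile1 //.
      by rewrite mulr_ge0 //; lra.
    by rewrite -subr_sqr expr1n; have := sqr_ge0 y; lra.
  have K : (b / c) ^+ m.+1 <= (1 + y) ^+ M.
    apply: le_trans (expr_1D_ge M y0).
    apply: (@le_trans _ _ (M.+1%:R * b ^+ m.+1)).
      rewrite expr_div_n mulrC ler_wpM2r ?ltW //.
      by rewrite exprn_gt0.
    have bm : b ^+ m.+1 <= y by apply: lerXn2r; rewrite ?nnegrE // ltW.
    rewrite -natr1 mulrDl mul1r.
    have : M%:R * b ^+ m.+1 <= M%:R * y by rewrite ler_wpM2l.
    lra.
  apply: (@le_trans _ _ ((c / b) ^+ m.+1)).
    have w0 : 0 <= 1 - y by lra.
    have := le_trans (ler_wpM2l (exprn_ge0 M w0) K) Q.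
    by rewrite -[b / c]invf_div exprVn ler_pdivrMr ?exprn_gt0 ?divr_gt0 // mul1r.
  apply: (@le_trans _ _ (eta * b)).
    rewrite exprS; apply: le_trans Hm2.
    rewrite ler_piMl ?exprn_ge0 ?divr_ge0 ?(ltW c0) ?(ltW b0) //.
    by rewrite ler_pdivrMr // mul1r ltW.
  by rewrite ler_pM2l.
Unshelve. all: by end_near. Qed.

End Step.

Section Tauberian.
Variable R : realType.
Implicit Types (x y r eta : R) (p : {poly R}).

Lemma cvg_sum_ord (T : Type) (F : set_system T) (FF : Filter F) (n : nat)
    (f : 'I_n -> T -> R) (l : 'I_n -> R) :
  (forall i, f i x @[x --> F] --> l i) ->
  \sum_(i < n) f i x @[x --> F] --> \sum_(i < n) l i.
Proof.
elim: n f l => [|n IH] f l H.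
  rewrite big_ord0; under eq_fun do rewrite big_ord0; exact: cvg_cst.
rewrite big_ord_recr; under eq_fun do rewrite big_ord_recr.
by apply: cvgD; [exact: IH | exact: H].
Qed.

(** The sum is a finite combination of the series at the points [x ^+ i]. The term [i = 0] would be
    the series at 1, outside the domain of [U]; [p.[0] = 0] removes it. The exponents [e] cover both
    [k] and [j * j]. *)
Lemma poly_series (e : nat -> nat) (w : nat -> R) (U : R -> R) p x :
  (forall y, 0 < y < 1 -> \sum_(k < N) w k * y ^+ e k @[N --> \oo] --> U y) ->
  p.[0] = 0 -> 0 < x < 1 ->
  \sum_(k < N) w k * p.[x ^+ e k] @[N --> \oo] --> \sum_(i < size p) p`_i * U (x ^+ i).
Proof.
move=> HU p0 /andP[x0 x1].
have -> : (fun N => \sum_(k < N) w k * p.[x ^+ e k]) =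
          (fun N => \sum_(i < size p) p`_i * \sum_(k < N) w k * (x ^+ i) ^+ e k).
  apply/funext => N.
  under eq_bigr do rewrite horner_coef mulr_sumr.
  rewrite exchange_big /=; apply: eq_bigr => i _.
  rewrite mulr_sumr; apply: eq_bigr => k _.
  by rewrite mulrCA -!exprM mulnC.
apply: cvg_sum_ord => -[[|i] Hi] /=.
  rewrite horner_coef0 in p0; rewrite p0 mul0r.
  under eq_fun do rewrite mul0r.
  exact: cvg_cst.
apply: cvgMl_tmp; apply: HU.
by rewrite exprn_gt0 // exprn_ilt1 // ltW.
Qed.

(** With [count_ge], this replaces the counting function of the squares by a square root; the error
    1 vanishes after division by [Num.sqrt n%:R]. *)
Lemma count_le (J : nat) y : 0 <= y -> \sum_(j < J) ((j%:R <= y)%R : nat)%:R <= y + 1 :> R.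
Proof.
move=> y0; elim: J => [|J IH]; first by rewrite big_ord0; lra.
rewrite big_ord_recr /=; case: (lerP J%:R y) => H /=; last by rewrite addr0.
apply: (@le_trans _ _ (J%:R + 1)); last by rewrite lerD2r.
rewrite lerD2r -[leRHS]/(J%:R) -[X in _ <= X%:R]card_ord -sumr_const ler_sum // => i _.
by rewrite -[leRHS]/(1%:R) ler_nat leq_b1.
Qed.

Lemma count_ge (J : nat) y : y <= J%:R -> y <= \sum_(j < J) ((j%:R <= y)%R : nat)%:R :> R.
Proof.
have key : Num.min J%:R y <= \sum_(j < J) ((j%:R <= y)%R : nat)%:R :> R.
  elim: J => [|J IH]; first by rewrite big_ord0 ge_min lexx.
  rewrite big_ord_recr /=; move: IH; rewrite !ge_min -natr1.
  case: (lerP J%:R y) => H /= /orP[] IH; apply/orP; rewrite ?addr0.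
  - by left; lra.
  - by right; lra.
  - by right; lra.
  - by right; lra.
by move=> yJ; move: key; rewrite min_r.
Qed.

Lemma expN_inv_bounds (n : nat) : (0 < n)%N -> 0 < expR (- n%:R^-1 : R) < 1.
Proof.
move=> n0; rewrite expR_gt0 /= expR_lt1 oppr_lt0 invr_gt0 ltr0n //.
Qed.

(* Karamata's argument, in comparative form: [a] and the indicator of the
   squares have asymptotically proportional integrals against every polynomial in
   [e^(-k/n)] without constant term, hence against step functions. *)
Lemma karamata_squares (a phi : nat -> R) (U V : R -> R) (kappa g : R) :
  (forall k, 0 <= a k) -> (\forall n \near \oo, 0 < phi n) ->
  (forall x, 0 < x < 1 -> \sum_(k < N) a k * x ^+ k @[N --> \oo] --> U x) ->
  (forall x, 0 < x < 1 -> \sum_(j < N) x ^+ (j * j) @[N --> \oo] --> V x) ->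
  (forall m, (0 < m)%N ->
    U (expR (- (m%:R / n%:R))) / phi n @[n --> \oo] --> kappa * (g / Num.sqrt m%:R)) ->
  (forall m, (0 < m)%N ->
    V (expR (- (m%:R / n%:R))) / Num.sqrt n%:R @[n --> \oo] --> g / Num.sqrt m%:R) ->
  0 <= kappa ->
  (\sum_(k < n.+1) a k) / phi n @[n --> \oo] --> kappa.
Proof.
move=> a0 phi0 HU HV limU limV kappa0.
pose x n : R := expR (- n%:R^-1).
have x01 n : (0 < n)%N -> 0 < x n < 1 by exact: expN_inv_bounds.
have xX n m : expR (- (m%:R / n%:R)) = x n ^+ m.
  by rewrite /x -expRM_natl mulrN.
pose I (W : R -> R) p n := \sum_(i < size p) p`_i * W (x n ^+ i).
have IU p n : p.[0] = 0 -> (0 < n)%N ->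
    \sum_(k < N) a k * p.[x n ^+ k] @[N --> \oo] --> I U p n.
  by move=> p0 n0; apply: (@poly_series id) => //; exact: x01.
have IV p n : p.[0] = 0 -> (0 < n)%N ->
    \sum_(k < N) p.[x n ^+ (k * k)] @[N --> \oo] --> I V p n.
  move=> p0 n0.
  have := @poly_series (fun k => k * k)%N (fun=> 1) V p (x n) _ p0 (x01 _ n0).
  under eq_fun do under eq_bigr do rewrite mul1r.
  by apply => y y01; under eq_fun do under eq_bigr do rewrite mul1r; exact: HV.
(* Both normalised series have limits proportional to [1 / sqrt m] at [x n ^+ m], so the comparison
   extends to polynomials by linearity. *)
have limI p : p.[0] = 0 ->
    I U p n / phi n - kappa * (I V p n / Num.sqrt n%:R) @[n --> \oo] --> (0 : R).
  move=> p0.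
  have -> : (fun n => I U p n / phi n - kappa * (I V p n / Num.sqrt n%:R)) =
     (fun n => \sum_(i < size p) p`_i *
        (U (x n ^+ i) / phi n - kappa * (V (x n ^+ i) / Num.sqrt n%:R))).
    apply/funext => n; rewrite /I !mulr_suml mulr_sumr -sumrB.
    by apply: eq_bigr => i _; ring.
  suff H : \sum_(i < size p) p`_i *
      (U (x n ^+ i) / phi n - kappa * (V (x n ^+ i) / Num.sqrt n%:R))
      @[n --> \oo] --> \sum_(i < size p) (0 : R) by rewrite big1 in H.
  apply: cvg_sum_ord => -[[|i] Hi] /=.
    rewrite horner_coef0 in p0; rewrite p0.
    under eq_fun do rewrite mul0r.
    exact: cvg_cst.
  rewrite -[X in _ --> X](mulr0 p`_i.+1).
  rewrite -(subrr (kappa * (g / Num.sqrt i.+1%:R))).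
  apply: cvgMl_tmp; apply: cvgB.
    by under eq_fun do rewrite -xX; exact: limU.
  by apply: cvgMl_tmp; under eq_fun do rewrite -xX; exact: limV.
have lU : U (x n) / phi n @[n --> \oo] --> kappa * g.
  have := limU 1%N isT; rewrite sqrtr1 divr1.
  by under eq_fun do rewrite xX expr1.
have lV : V (x n) / Num.sqrt n%:R @[n --> \oo] --> g.
  have := limV 1%N isT; rewrite sqrtr1 divr1.
  by under eq_fun do rewrite xX expr1.
have lS : (Num.sqrt n%:R)^-1 @[n --> \oo] --> (0 : R).
  rewrite -[X in _ --> X]sqrtr0.
  have -> : (fun n => (Num.sqrt n%:R)^-1 : R) = (fun n => Num.sqrt (n%:R^-1)).
    by apply/funext => n; rewrite sqrtrV.
  have H : \forall n \near \oo, 0 < (n%:R : R).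
    by near=> n; rewrite ltr0n; near: n; exact: nbhs_infty_gt.
  have K : (n%:R^-1 : R) @[n --> \oo] --> 0.
    by have /(_ _)/iffRL := gtr0_cvgV0 H; apply => //; exact: cvgr_idn.
  exact: (cvg_comp _ _ K (@sqrt_continuous R 0)).
have sumT n N : (n < N)%N ->
    \sum_(k < N) a k * ((k <= n)%N : nat)%:R = \sum_(k < n.+1) a k.
  move=> nN; rewrite [RHS](big_ord_widen N) // [RHS]big_mkcond /=.
  by apply: eq_bigr => k _; rewrite ltnS; case: (_ <= n)%N; rewrite ?mulr1 ?mulr0.
have xpow n m : (0 < n)%N -> 0 <= x n ^+ m <= 1.
  move=> /x01 /andP[h1 h2]; rewrite exprn_ge0 ?exprn_ile1 //; lra.
have gt0 : \forall n \near \oo, (0 < n)%N by exact: nbhs_infty_gt.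
have upper eta : 0 < eta < 1 -> \forall n \near \oo,
    (\sum_(k < n.+1) a k) / phi n <= kappa + eta * (kappa + 2 * kappa * g + 1).
  move=> /andP[e0 e1].
  (* The condition [k <= n] reads [x n ^+ k >= expR (- 1)], and [j >= (1 + eta) sqrt n] reads [x n
     ^+ (j * j) <= expR (- (1 + eta) ^+ 2)]. So [p] dominates the indicator of [k <= n] up to
     [eta * x], while on the squares it is nearly 0 past [(1 + eta) sqrt n]. *)
  have [||||p [p0 p01 pa pb]] :=
      @step_poly R (expR (- (1 + eta) ^+ 2)) (expR (- 1)) eta.
  - exact: expR_gt0.
  - by rewrite ltr_expR ltrN2; nra.
  - by rewrite expR_le1 lerN10.
  - exact: e0.
  have claim1 n : (0 < n)%N -> \sum_(k < n.+1) a k <= I U p n + eta * U (x n).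
    move=> n0.
    have L : \sum_(k < N) a k * p.[x n ^+ k] + eta * \sum_(k < N) a k * x n ^+ k
       @[N --> \oo] --> I U p n + eta * U (x n).
      apply: cvgD; first exact: IU.
      by apply: cvgMl_tmp; apply: HU; exact: x01.
    apply: (cvgr_to_ge L); exists n.+1 => // N /= nN.
    rewrite -(sumT _ _ nN) mulr_sumr -big_split /=; apply: ler_sum => k _.
    rewrite [X in _ <= _ + X]mulrCA -mulrDr; apply: ler_wpM2l => //.
    have /andP[X0 X1] := xpow n k n0.
    have /p01 /andP[P0 P1] := xpow n k n0.
    have Y0 : 0 <= eta * x n ^+ k by rewrite mulr_ge0 // ltW.
    case: (leqP k n) => kn /=; last by lra.
    suff : expR (- 1) <= x n ^+ k.
      by move=> h; have := pb (x n ^+ k); rewrite h X1 => /(_ isT); lra.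
    rewrite -xX ler_expR lerN2 ler_pdivrMr ?ltr0n // mul1r ler_nat //.
  have claim2 n : (0 < n)%N ->
      I V p n <= (1 + eta) * Num.sqrt n%:R + 1 + eta * V (x n).
    move=> n0; rewrite -lerBlDr.
    have L : \sum_(j < N) p.[x n ^+ (j * j)] - eta * \sum_(j < N) x n ^+ (j * j)
       @[N --> \oo] --> I V p n - eta * V (x n).
      apply: cvgB; first exact: IV.
      by apply: cvgMl_tmp; apply: HV; exact: x01.
    have y0 : 0 <= (1 + eta) * Num.sqrt n%:R by rewrite mulr_ge0 ?sqrtr_ge0 //; lra.
    apply: (cvgr_to_le L); near=> N.
    apply: le_trans (count_le N y0).
    rewrite mulr_sumr -sumrB; apply: ler_sum => j _.
    have /andP[X0 X1] := xpow n (j * j)%N n0.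
    have /p01 /andP[P0 P1] := xpow n (j * j)%N n0.
    have Y0 : 0 <= eta * x n ^+ (j * j) by rewrite mulr_ge0 // ltW.
    case: (lerP j%:R) => jy /=; first by lra.
    suff : x n ^+ (j * j) <= expR (- (1 + eta) ^+ 2).
      by move=> h; have := pa (x n ^+ (j * j)); rewrite h X0 => /(_ isT); lra.
    rewrite -xX ler_expR lerN2 ler_pdivlMr ?ltr0n //.
    have -> : (1 + eta) ^+ 2 * n%:R = ((1 + eta) * Num.sqrt n%:R) ^+ 2.
      by rewrite exprMn sqr_sqrtr.
    by rewrite natrM -expr2; apply: lerXn2r; rewrite ?nnegrE // ltW.
  have L : (I U p n / phi n - kappa * (I V p n / Num.sqrt n%:R))
       + kappa * ((1 + eta) + (Num.sqrt n%:R)^-1 + eta * (V (x n) / Num.sqrt n%:R))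
       + eta * (U (x n) / phi n) @[n --> \oo] -->
       0 + kappa * ((1 + eta) + 0 + eta * g) + eta * (kappa * g).
    apply: cvgD; last exact: cvgMl_tmp.
    apply: cvgD; first exact: limI.
    apply: cvgMl_tmp; apply: cvgD; last exact: cvgMl_tmp.
    by apply: cvgD => //; exact: cvg_cst.
  (* The limit in [L] is [kappa + eta * (kappa + 2 * kappa * g)]; the additional [eta] makes the
     inequality strict. *)
  have LL := cvgr_le _ L (kappa + eta * (kappa + 2 * kappa * g + 1)).
  near=> n.
  have n0 : (0 < n)%N by near: n.
  have f0 : 0 < phi n by near: n.
  have s0 : 0 < Num.sqrt n%:R :> R by rewrite sqrtr_gt0 ltr0n.
  apply: (@le_trans _ _ ((I U p n / phi n - kappa * (I V p n / Num.sqrt n%:R))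
       + kappa * ((1 + eta) + (Num.sqrt n%:R)^-1 + eta * (V (x n) / Num.sqrt n%:R))
       + eta * (U (x n) / phi n))); last by near: n; apply: LL; nra.
  apply: (@le_trans _ _ ((I U p n + eta * U (x n)) / phi n)).
    by rewrite ler_pM2r ?invr_gt0 //; exact: claim1.
  rewrite mulrDl [eta * U _ / _]mulrAC -!mulrA [X in _ + X]mulrCA.
  have : kappa * (I V p n / Num.sqrt n%:R) <=
    kappa * ((1 + eta) + (Num.sqrt n%:R)^-1 + eta * (V (x n) / Num.sqrt n%:R)).
    apply: ler_wpM2l => //; rewrite ler_pdivrMr // !mulrDl mulVf ?gt_eqF //.
    rewrite -!mulrA mulVf ?gt_eqF // mulr1 mul1r.
    by have := claim2 n n0; lra.
  rewrite !mulrA; lra.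
have lower eta : 0 < eta < 1 -> \forall n \near \oo,
    kappa - eta * (kappa + 2 * kappa * g + 1) <= (\sum_(k < n.+1) a k) / phi n.
  move=> /andP[e0 e1].
  (* Mirror image: [p] is nearly 0 for [k > n] and nearly 1 on the squares with
     [j <= (1 - eta) sqrt n]. *)
  have [||||p [p0 p01 pa pb]] :=
      @step_poly R (expR (- 1)) (expR (- (1 - eta) ^+ 2)) eta.
  - exact: expR_gt0.
  - by rewrite ltr_expR ltrN2; nra.
  - by rewrite expR_le1 oppr_le0 sqr_ge0.
  - exact: e0.
  have claim1 n : (0 < n)%N -> I U p n - eta * U (x n) <= \sum_(k < n.+1) a k.
    move=> n0.
    have L : \sum_(k < N) a k * p.[x n ^+ k] - eta * \sum_(k < N) a k * x n ^+ k
       @[N --> \oo] --> I U p n - eta * U (x n).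
      apply: cvgB; first exact: IU.
      by apply: cvgMl_tmp; apply: HU; exact: x01.
    apply: (cvgr_to_le L); exists n.+1 => // N /= nN.
    rewrite -(sumT _ _ nN) mulr_sumr -sumrB /=; apply: ler_sum => k _.
    rewrite [X in _ - X <= _]mulrCA -mulrBr; apply: ler_wpM2l => //.
    have /andP[X0 X1] := xpow n k n0.
    have /p01 /andP[P0 P1] := xpow n k n0.
    have Y0 : 0 <= eta * x n ^+ k by rewrite mulr_ge0 // ltW.
    case: (leqP k n) => kn /=; first by lra.
    suff : x n ^+ k <= expR (- 1).
      by move=> h; have := pa (x n ^+ k); rewrite h X0 => /(_ isT); lra.
    rewrite -xX ler_expR lerN2 ler_pdivlMr ?ltr0n // mul1r ler_nat ltnW //.
  have claim2 n : (0 < n)%N ->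
      (1 - eta) * Num.sqrt n%:R <= I V p n + eta * V (x n).
    move=> n0.
    have L : \sum_(j < N) p.[x n ^+ (j * j)] + eta * \sum_(j < N) x n ^+ (j * j)
       @[N --> \oo] --> I V p n + eta * V (x n).
      apply: cvgD; first exact: IV.
      by apply: cvgMl_tmp; apply: HV; exact: x01.
    have y0 : 0 <= (1 - eta) * Num.sqrt n%:R by rewrite mulr_ge0 ?sqrtr_ge0 //; lra.
    apply: (cvgr_to_ge L); near=> N.
    have yN : (1 - eta) * Num.sqrt n%:R <= N%:R.
      by near: N; exact: nbhs_infty_ger.
    apply: le_trans (count_ge yN) _.
    rewrite mulr_sumr -big_split; apply: ler_sum => j _ /=.
    have /andP[X0 X1] := xpow n (j * j)%N n0.
    have /p01 /andP[P0 P1] := xpow n (j * j)%N n0.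
    have Y0 : 0 <= eta * x n ^+ (j * j) by rewrite mulr_ge0 // ltW.
    case: (lerP j%:R) => jy /=; last by lra.
    suff : expR (- (1 - eta) ^+ 2) <= x n ^+ (j * j).
      by move=> h; have := pb (x n ^+ (j * j)); rewrite h X1 => /(_ isT); lra.
    rewrite -xX ler_expR lerN2 ler_pdivrMr ?ltr0n //.
    have -> : (1 - eta) ^+ 2 * n%:R = ((1 - eta) * Num.sqrt n%:R) ^+ 2.
      by rewrite exprMn sqr_sqrtr.
    by rewrite natrM -expr2; apply: lerXn2r; rewrite ?nnegrE.
  have L : (I U p n / phi n - kappa * (I V p n / Num.sqrt n%:R))
       + kappa * ((1 - eta) - eta * (V (x n) / Num.sqrt n%:R))
       - eta * (U (x n) / phi n) @[n --> \oo] -->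
       0 + kappa * ((1 - eta) - eta * g) - eta * (kappa * g).
    apply: cvgB; last exact: cvgMl_tmp.
    apply: cvgD; first exact: limI.
    apply: cvgMl_tmp; apply: cvgB; last exact: cvgMl_tmp.
    exact: cvg_cst.
  have LL := cvgr_ge _ L (kappa - eta * (kappa + 2 * kappa * g + 1)).
  near=> n.
  have n0 : (0 < n)%N by near: n.
  have f0 : 0 < phi n by near: n.
  have s0 : 0 < Num.sqrt n%:R :> R by rewrite sqrtr_gt0 ltr0n.
  apply: (@le_trans _ _ ((I U p n / phi n - kappa * (I V p n / Num.sqrt n%:R))
       + kappa * ((1 - eta) - eta * (V (x n) / Num.sqrt n%:R))
       - eta * (U (x n) / phi n))); first by near: n; apply: LL; nra.
  apply: (@le_trans _ _ ((I U p n - eta * U (x n)) / phi n)); last first.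
    by rewrite ler_pM2r ?invr_gt0 //; exact: claim1.
  have : kappa * ((1 - eta) - eta * (V (x n) / Num.sqrt n%:R)) <=
      kappa * (I V p n / Num.sqrt n%:R).
    apply: ler_wpM2l => //; rewrite ler_pdivlMr // !mulrBl.
    rewrite -!mulrA mulVf ?gt_eqF // mulr1 mul1r.
    by have := claim2 n n0; lra.
  rewrite mulrBl !mulrA; lra.
have g0 : 0 <= g.
  apply: (cvgr_to_ge lV); near=> n.
  have n0 : (0 < n)%N by near: n.
  rewrite divr_ge0 ?sqrtr_ge0 //.
  apply: (cvgr_to_ge (HV _ (x01 _ n0))); near=> N.
  by apply: sumr_ge0 => j _; have /andP[] := xpow n (j * j)%N n0.
apply/cvgrPdist_le => e e0.
pose C := kappa + 2 * kappa * g + 1.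
have C0 : 0 < C by rewrite /C; nra.
pose eta := Num.min (e / C) (1 / 2).
have eta01 : 0 < eta < 1.
  by rewrite /eta lt_min gt_min divr_gt0 //=; apply/andP; split; [lra|apply/orP; right; lra].
have etaC : eta * C <= e by rewrite -ler_pdivlMr // /eta ge_min lexx.
have Hu := upper _ eta01; have Hl := lower _ eta01.
near=> n; rewrite ler_distlC.
have h1 : (\sum_(k < n.+1) a k) / phi n <= kappa + eta * C by near: n.
have h2 : kappa - eta * C <= (\sum_(k < n.+1) a k) / phi n by near: n.
by apply/andP; split; lra.
Unshelve. all: by end_near. Qed.
End Tauberian.

(** * Generating function of the squares as a Riemann sum *)

Section Gauss.
Variable R : realType.
Implicit Types (x y h a b : R).
Import gauss_integral_proof.
Local Notation F := (@integral0_gauss R).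
Local Notation L := (Num.sqrt pi / 2 : R).

Lemma cvg_integral0_gauss : F x @[x --> +oo] --> L.
Proof.
have : Num.sqrt (F x ^+ 2) @[x --> +oo] --> Num.sqrt (pi / 4 : R).
  by apply: continuous_cvg; [exact: sqrt_continuous|exact: cvg_integral0_gauss_sqr].
under eq_fun do rewrite sqrtr_sqr ger0_norm ?integral0_gauss_ge0 //.
rewrite sqrtrM ?pi_ge0 // sqrtrV // (_ : 4 = 2 ^+ 2); last by rewrite expr2 -natrM.
by rewrite sqrtr_sqr ger0_norm.
Qed.

(** Mean value theorem for [F], whose derivative [gauss_fun] decreases on the nonnegative reals. *)
Lemma integral0_gauss_increment a b : 0 <= a -> a <= b ->
  (b - a) * gauss_fun b <= F b - F a <= (b - a) * gauss_fun a.
Proof.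
move=> a0 ab.
have gi x : lebesgue_measure.-integrable `[0, x] (EFin \o @gauss_fun R).
  apply: continuous_compact_integrable => //; first exact: segment_compact.
  by apply: continuous_subspaceT; exact: continuous_gauss_fun.
have dF x : x \in `]a, b[ -> is_derive x 1 F (gauss_fun x).
  rewrite in_itv /= => /andP[ax xb].
  have x0 : 0 < x by lra.
  have [D E] := continuous_FTC1_closed (ltr_pwDr ltr01 (lexx x)) (gi (x + 1)) x0
    (@continuous_gauss_fun R x).
  by apply: DeriveDef => //; rewrite -derive1E.
have cF : {within `[a, b], continuous F}.
  apply: (@continuous_subspaceW _ _ _ `[0, b]).
    by move=> x /=; rewrite !in_itv /= => /andP[ax ->]; rewrite (le_trans a0 ax).
  by apply: parameterized_integral_continuous => //=; exact: le_trans ab.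
have [c + ->] := MVT_segment ab dF cF.
rewrite in_itv /= => /andP[ac cb].
have mono x y : 0 <= x -> x <= y -> gauss_fun y <= gauss_fun x.
  move=> x0 xy; rewrite ler_expR lerN2; apply: lerXn2r; rewrite ?nnegrE //.
  exact: le_trans xy.
by rewrite mulrC [_ * gauss_fun a]mulrC !ler_wpM2r ?mono ?subr_ge0 //; lra.
Qed.

Lemma integral0_gauss_le x : 0 <= x -> F x <= L.
Proof.
move=> x0; apply: (cvgr_to_ge cvg_integral0_gauss).
near=> y.
have xy : x <= y by near: y; apply: nbhs_pinfty_ge; exact: num_real.
have := integral0_gauss_increment x0 xy.
have : 0 <= (y - x) * gauss_fun y by rewrite mulr_ge0 ?gauss_fun_ge0 //; lra.
lra.
Unshelve. all: by end_near. Qed.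

(** For a decreasing integrand the left Riemann sum exceeds the integral by at most its first term,
    here [h * gauss_fun 0 = h]. *)
Lemma gauss_sum_bounds h (N : nat) : 0 < h ->
  F (N%:R * h) <= h * \sum_(j < N) gauss_fun (j%:R * h) <= h + F (N%:R * h).
Proof.
move=> h0.
have F0 : F 0 = 0 by rewrite /integral0_gauss set_itv1 Rintegral_set1.
have inc (k : nat) := @integral0_gauss_increment (k%:R * h) (k.+1%:R * h)
  (mulr_ge0 (ler0n _ _) (ltW h0)).
have inc' (k : nat) : h * gauss_fun (k.+1%:R * h) <= F (k.+1%:R * h) - F (k%:R * h)
    <= h * gauss_fun (k%:R * h).
  have := inc k; have -> : k.+1%:R * h - k%:R * h = h by rewrite -natr1; ring.
  by apply; rewrite ler_pM2r // ler_nat.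
have up (k : nat) : h * \sum_(j < k.+1) gauss_fun (j%:R * h) <= h + F (k%:R * h).
  elim: k => [|k IH].
    by rewrite big_ord1 mul0r F0 addr0 ger_pMr // gauss_fun_le1.
  rewrite big_ord_recr /= mulrDr; have := inc' k; lra.
have low (k : nat) : F (k%:R * h) <= h * \sum_(j < k) gauss_fun (j%:R * h).
  elim: k => [|k IH]; first by rewrite big_ord0 mul0r F0 mulr0.
  rewrite big_ord_recr /= mulrDr; have := inc' k; lra.
rewrite low /=; case: N => [|N]; first by rewrite big_ord0 mul0r F0; lra.
have := up N; have := inc' N.
have : 0 <= h * gauss_fun (N.+1%:R * h) by rewrite mulr_ge0 ?gauss_fun_ge0 // ltW.
lra.
Qed.

(** At [x = expR (- h ^+ 2)] the term [x ^+ (j * j)] equals [gauss_fun (j%:R * h)], so the bounds on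
    Riemann sums of mesh [h] pass to the limit. *)
Lemma square_series : exists V : R -> R,
  (forall x, 0 < x < 1 -> \sum_(j < N) x ^+ (j * j) @[N --> \oo] --> V x) /\
  (forall h, 0 < h -> L <= h * V (expR (- h ^+ 2)) <= h + L).
Proof.
have E h (j : nat) : expR (- h ^+ 2) ^+ (j * j) = gauss_fun (j%:R * h).
  by rewrite -expRM_natl /gauss_fun exprMn natrM mulrN -expr2.
have H h : 0 < h -> \sum_(j < N) expR (- h ^+ 2) ^+ (j * j) @[N --> \oo] -->
    limn (fun N => \sum_(j < N) expR (- h ^+ 2) ^+ (j * j)).
  move=> h0; apply: nondecreasing_is_cvgn.
    apply/nondecreasing_seqP => n.
    by rewrite big_ord_recr /= lerDl exprn_ge0 // expR_ge0.
  exists ((h + L) / h) => _ [N _ <-].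
  rewrite ler_pdivlMr // mulrC.
  under eq_bigr do rewrite E.
  have /andP[_ +] := gauss_sum_bounds N h0.
  have : F (N%:R * h) <= L by apply: integral0_gauss_le; rewrite mulr_ge0 // ltW.
  lra.
exists (fun x => limn (fun N => \sum_(j < N) x ^+ (j * j))); split.
  move=> x /andP[x0 x1].
  have l0 : 0 < - ln x by rewrite oppr_gt0 ln_lt0 // x0.
  have xE : x = expR (- Num.sqrt (- ln x) ^+ 2).
    by rewrite sqr_sqrtr ?ltW // opprK lnK.
  by rewrite xE; apply: H; rewrite sqrtr_gt0.
move=> h h0; have {}H := H _ h0.
have HM : h * \sum_(j < N) expR (- h ^+ 2) ^+ (j * j) @[N --> \oo] -->
   h * limn (fun N => \sum_(j < N) expR (- h ^+ 2) ^+ (j * j)) by exact: cvgMl_tmp.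
have FN : F (N%:R * h) @[N --> \oo] --> L.
  have K : (n%:R * h) @[n --> \oo] --> +oo.
    apply/cvgryPge => A; near=> n; rewrite -ler_pdivrMr //.
    by near: n; exact: nbhs_infty_ger.
  exact: (cvg_comp _ _ K cvg_integral0_gauss).
apply/andP; split.
  apply: (ler_cvg_to FN HM); apply: nearW => N.
  under eq_bigr do rewrite E.
  by have /andP[] := gauss_sum_bounds N h0.
apply: (cvgr_to_le HM); apply: nearW => N.
under eq_bigr do rewrite E.
have /andP[_ +] := gauss_sum_bounds N h0.
have : F (N%:R * h) <= L by apply: integral0_gauss_le; rewrite mulr_ge0 // ltW.
lra.
Unshelve. all: by end_near. Qed.

End Gauss.

(** * Hitting generating functions on a tooth *)

Section Tooth.
Variable R : realType.
Implicit Types (l : R) (y : nat).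

(* [l] and [a = half_angle l] are the generating functions of the first passage to
   a neighbouring vertex, along the spine and down a tooth; the time variable is
   [half_angle a]. [tooth_hit l y] is the generating function of the hitting time
   of height [y] from the foot of the tooth; [tooth_den l j] is the combination of
   [a ^+ j] and [a ^- j] compatible with the equation at the foot. *)
Definition half_angle l : R := 2 * l / (1 + l ^+ 2).
Definition gap l : R := l^-1 - l.
Definition tooth_den l y : R :=
  let a := half_angle l in gap l * (a ^- y - a ^+ y) + gap a * a ^+ y.
Definition tooth_hit l y : R := gap (half_angle l) / tooth_den l y.

Lemma half_angle_itv l : 0 < l < 1 -> 0 < half_angle l < 1.
Proof.
move=> /andP[l0 l1]; rewrite /half_angle.
have p : 0 < 1 + l ^+ 2 by have := sqr_ge0 l; lra.
rewrite divr_gt0 ?mulr_gt0 //= ltr_pdivrMr // mul1r.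
have : 0 < (1 - l) ^+ 2 by rewrite exprn_gt0 // subr_gt0.
by rewrite sqrrB expr1n mul1r; lra.
Qed.

Lemma gap_gt0 l : 0 < l < 1 -> 0 < gap l.
Proof.
move=> /andP[l0 l1]; rewrite /gap subr_gt0 (lt_trans l1) //.
by rewrite invf_gt1.
Qed.

(** For [a = e^(-s)] these are the inequalities [y sinh s <= sinh (y s) <= y (sinh s) e^(y s)],
    doubled. *)
Lemma pow_gap_bounds a y : 0 < a < 1 ->
  y%:R * gap a <= a ^- y - a ^+ y <= y%:R * gap a * a ^- y.
Proof.
move=> a01; have /andP[a0 a1] := a01; have d0 := gap_gt0 a01.
have A1 : 1 <= a^-1 by rewrite invf_ge1 // ltW.
have E k : a ^- k.+1 - a ^+ k.+1 = a^-1 * (a ^- k - a ^+ k) + gap a * a ^+ k.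
  by rewrite exprS invfM /gap; ring.
have p1 k : a ^+ k <= 1 by rewrite exprn_ile1 // ltW.
have p0 k : 0 < a ^+ k by rewrite exprn_gt0.
have P1 k : 1 <= a ^- k by rewrite invf_ge1.
elim: y => [|y /andP[IH1 IH2]]; first by rewrite expr0 invr1; lra.
rewrite E; apply/andP; split.
  have B : 1 - y%:R * (1 - a) <= a ^+ y.
    have := @expr_1B_ge R (1 - a) y; rewrite subKr; apply.
  by rewrite subr_ge0 (ltW a1) /= gerBl ltW.
  have A2 : 1 - a <= a^-1 - 1.
    have : 0 <= (1 - a) ^+ 2 / a by rewrite divr_ge0 ?sqr_ge0 // ltW.
    suff -> : (1 - a) ^+ 2 / a = a^-1 - 1 - (1 - a) by lra.
    by field; rewrite gt_eqF.
  have A3 : y%:R * (1 - a) <= y%:R * (a^-1 - 1) by rewrite ler_wpM2l.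
  apply: (@le_trans _ _ (a^-1 * (y%:R * gap a) + gap a * a ^+ y)); last first.
    by rewrite lerD2r ler_wpM2l //; lra.
  have -> : a^-1 * (y%:R * gap a) + gap a * a ^+ y = (y%:R * a^-1 + a ^+ y) * gap a by ring.
  rewrite ler_pM2r // -natr1; lra.
apply: (@le_trans _ _ (a^-1 * (y%:R * gap a * a ^- y) + gap a * 1)).
  by apply: lerD; [rewrite ler_wpM2l // ltW // invr_gt0|rewrite ler_wpM2l // ltW].
have -> : y.+1%:R * gap a * a ^- y.+1 =
    a^-1 * (y%:R * gap a * a ^- y) + gap a * a ^- y.+1.
  by rewrite -natr1 exprS invfM; ring.
by rewrite lerD2l ler_wpM2l // ltW.
Qed.

Lemma tooth_den_gt0 l y : 0 < l < 1 -> 0 < tooth_den l y.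
Proof.
move=> l01; have a01 := half_angle_itv l01; have /andP[a0 a1] := a01.
rewrite /tooth_den; apply: ltr_wpDl; last by rewrite mulr_gt0 ?gap_gt0 ?exprn_gt0.
apply: mulr_ge0; first by rewrite ltW // gap_gt0.
have /andP[H _] := pow_gap_bounds y a01; apply: le_trans H.
by rewrite mulr_ge0 // ltW // gap_gt0.
Qed.

Lemma tooth_hit_ge0 l y : 0 < l < 1 -> 0 <= tooth_hit l y.
Proof.
move=> l01; rewrite divr_ge0 // ltW ?tooth_den_gt0 //.
by apply: gap_gt0; exact: half_angle_itv.
Qed.

Lemma half_angleB l : 0 < l -> 1 - half_angle l = (1 - l) ^+ 2 / (1 + l ^+ 2).
Proof.
move=> l0; rewrite /half_angle; field.
by rewrite gt_eqF //; nra.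
Qed.

Lemma gap_half_angle_le l : 0 < l < 1 -> gap (half_angle l) <= gap l.
Proof.
move=> l01; have /andP[l0 l1] := l01; have /andP[a0 a1] := half_angle_itv l01.
have la : l <= half_angle l.
  by rewrite /half_angle ler_pdivlMr; nra.
by rewrite /gap lerB // lef_pV2 ?posrE.
Qed.

(** With [a = half_angle l], replacing [gap l] by the smaller [gap a] in [tooth_den l y] leaves
    [gap a * a ^- y], which is at least [gap a]. *)
Lemma tooth_hit_le1 l y : 0 < l < 1 -> tooth_hit l y <= 1.
Proof.
move=> l01; rewrite ler_pdivrMr ?tooth_den_gt0 // mul1r /tooth_den /=.
have a01 := half_angle_itv l01; have /andP[a0 a1] := a01.
have cd := gap_half_angle_le l01; have d0 := gap_gt0 a01.
have A0 : 0 <= half_angle l ^- y - half_angle l ^+ y.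
  have /andP[H _] := pow_gap_bounds y a01; apply: le_trans H.
  by rewrite mulr_ge0 // ltW.
apply: (@le_trans _ _ (gap (half_angle l) * half_angle l ^- y)).
  by rewrite ler_peMr ?invf_ge1 ?exprn_gt0 ?exprn_ile1 // ltW.
rewrite -lerBlDr -mulrBr; exact: ler_wpM2r.
Qed.

Lemma tooth_hit_le_inv l y : 0 < l < 1 -> (0 < y)%N ->
  tooth_hit l y <= (gap l)^-1 * y%:R^-1.
Proof.
move=> l01 y0; have a01 := half_angle_itv l01; have /andP[a0 a1] := a01.
have d0 := gap_gt0 a01; have c0 := gap_gt0 l01.
have yR : 0 < y%:R :> R by rewrite ltr0n.
rewrite ler_pdivrMr ?tooth_den_gt0 // -invfM mulrC ler_pdivlMr ?mulr_gt0 //.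
rewrite /tooth_den /=.
have /andP[H _] := pow_gap_bounds y a01.
have := ler_wpM2l (ltW c0) H.
have : 0 <= gap (half_angle l) * half_angle l ^+ y by rewrite mulr_ge0 ?exprn_ge0 // ltW.
lra.
Qed.

(** The upper half of [pow_gap_bounds] gives [tooth_hit l y >= a ^+ y / (gap l * y + 1)], and
    Bernoulli gives [a ^+ y >= 1 - y (1 - a)]. The subtracted term bounds the resulting loss by a
    quantity independent of [y]. *)
Lemma tooth_hit_ge l y : 0 < l < 1 -> y%:R * (1 - half_angle l) <= 1 ->
  (gap l)^-1 * (y%:R + (gap l)^-1)^-1 - (1 - half_angle l) / gap l <= tooth_hit l y.
Proof.
move=> l01 Hy; have a01 := half_angle_itv l01; have /andP[a0 a1] := a01.
have d0 := gap_gt0 a01; have c0 := gap_gt0 l01.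
set a := half_angle l in Hy a01 a0 a1 d0 *; set c := gap l in c0 *.
have yc0 : 0 < c * y%:R + 1 by rewrite ltr_wpDl // mulr_ge0 // ltW.
have ay1 : a ^+ y <= 1 by rewrite exprn_ile1 // ltW.
have ay0 : 0 < a ^+ y by rewrite exprn_gt0.
apply: (@le_trans _ _ (a ^+ y / (c * y%:R + 1))); last first.
  rewrite /tooth_hit -/a ler_pdivlMr ?tooth_den_gt0 // mulrAC ler_pdivrMr //.
  rewrite /tooth_den /= -/a -/c.
  have /andP[_ H] := pow_gap_bounds y a01.
  have H2 : a ^+ y * (a ^- y - a ^+ y) <= y%:R * gap a.
    apply: (@le_trans _ _ (a ^+ y * (y%:R * gap a * a ^- y))); first by rewrite ler_pM2l.
    by rewrite mulrCA mulfV ?gt_eqF // mulr1.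
  have -> : a ^+ y * (c * (a ^- y - a ^+ y) + gap a * a ^+ y) =
      c * (a ^+ y * (a ^- y - a ^+ y)) + gap a * (a ^+ y * a ^+ y) by ring.
  have -> : gap a * (c * y%:R + 1) = c * (y%:R * gap a) + gap a * 1 by ring.
  by rewrite lerD ?ler_pM2l // mulr_ile1 // ltW.
have B : 1 - y%:R * (1 - a) <= a ^+ y.
  have := @expr_1B_ge R (1 - a) y; rewrite subKr; apply.
  by rewrite subr_ge0 (ltW a1) /= gerBl ltW.
apply: (@le_trans _ _ ((1 - y%:R * (1 - a)) / (c * y%:R + 1))); last first.
  by rewrite ler_pM2r ?invr_gt0.
rewrite [leRHS]mulrBl lerB //.
  by rewrite mul1r -invfM mulrDr mulfV ?gt_eqF.
rewrite ler_pdivrMr // mulrAC ler_pdivlMr //.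
have : 0 <= 1 - a by lra.
nra.
Qed.

(** In this range Bernoulli gives [a ^- y >= 2], hence [a ^+ y <= 1/2 <= a ^- y / 4] and
    [a ^- y - a ^+ y >= 3/4 * a ^- y], which is the origin of [4 / 3]. *)
Lemma tooth_hit_tail l y : 0 < l < 1 -> 1 <= y%:R * (1 - half_angle l) ->
  tooth_hit l y <= 4 / 3 * (gap (half_angle l) / gap l) * half_angle l ^+ y.
Proof.
move=> l01 Hy; have a01 := half_angle_itv l01; have /andP[a0 a1] := a01.
have d0 := gap_gt0 a01; have c0 := gap_gt0 l01.
set a := half_angle l in Hy a01 a0 a1 d0 *; set c := gap l in c0 *.
have ay0 : 0 < a ^+ y by rewrite exprn_gt0.
have A2 : 1 - a <= a^-1 - 1.
  have : 0 <= (1 - a) ^+ 2 / a by rewrite divr_ge0 ?sqr_ge0 // ltW.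
  suff -> : (1 - a) ^+ 2 / a = a^-1 - 1 - (1 - a) by lra.
  by field; rewrite gt_eqF.
have H2 : 2 <= a ^- y.
  have H : 0 <= a^-1 - 1 by lra.
  have := expr_1D_ge y H; rewrite [1 + (_ - _)]addrC subrK exprVn.
  have : y%:R * (1 - a) <= y%:R * (a^-1 - 1) by rewrite ler_wpM2l.
  lra.
have Hh : a ^+ y <= 1 / 2.
  by rewrite -[a ^+ y]invrK -[1 / 2]invf_div divr1 lef_pV2 ?posrE ?invr_gt0 //.
have K : 3 / 4 * a ^- y <= a ^- y - a ^+ y by lra.
rewrite /tooth_hit -/a ler_pdivrMr ?tooth_den_gt0 //.
have -> : 4 / 3 * (gap a / c) * a ^+ y * tooth_den l y =
   gap a * (4 / 3 / c * a ^+ y * tooth_den l y) by ring.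
rewrite ler_peMr ?(ltW d0) //.
apply: (@le_trans _ _ (4 / 3 / c * a ^+ y * (c * (3 / 4 * a ^- y)))).
  by rewrite le_eqVlt; apply/orP; left; apply/eqP; field; rewrite !gt_eqF.
rewrite ler_pM2l ?mulr_gt0 ?invr_gt0 // /tooth_den -/a -/c /=.
have : c * (3 / 4 * a ^- y) <= c * (a ^- y - a ^+ y) by rewrite ler_pM2l.
have : 0 < gap a * a ^+ y by rewrite mulr_gt0.
lra.
Qed.

Lemma ln_step (x : R) : 0 < x -> (x + 1)^-1 <= ln (x + 1) - ln x <= x^-1.
Proof.
move=> x0; have x1 : 0 < x + 1 by lra.
apply/andP; split.
  have h : 0 < x / (x + 1) by rewrite divr_gt0.
  have := le_ln1Dx (x := x / (x + 1) - 1).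
  rewrite [1 + _]addrC subrK lnM ?posrE ?invr_gt0 // lnV ?posrE // => H.
  have : ln x - ln (x + 1) <= x / (x + 1) - 1 by apply: H; lra.
  have -> : x / (x + 1) - 1 = - (x + 1)^-1 by field; rewrite gt_eqF.
  lra.
have h : 0 < x^-1 by rewrite invr_gt0.
have := le_ln1Dx (x := x^-1).
have -> : 1 + x^-1 = (x + 1) / x by field; rewrite gt_eqF.
by rewrite lnM ?posrE // lnV ?posrE //; apply; lra.
Qed.

End Tooth.

(** * Logarithmic growth of the sum over a tooth *)

Section ToothSum.
Variable R : realType.
Implicit Types (l x : R) (k n : nat).

Lemma harmonic_ge x k : 0 < x ->
  ln (k%:R + 1 + x) - ln (1 + x) <= \sum_(i < k) (i.+1%:R + x)^-1.
Proof.
move=> x0; elim: k => [|k IH]; first by rewrite big_ord0 add0r subrr.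
have h : 0 < k%:R + 1 + x by have := ler0n R k; lra.
rewrite big_ord_recr /= -natr1; have := ln_step h.
have -> : k%:R + 1 + x + 1 = k%:R + 1 + 1 + x by ring.
lra.
Qed.

Lemma harmonic_le n k : (0 < n)%N ->
  \sum_(i < k) (n + i).+1%:R^-1 <= ln ((n + k)%:R : R) - ln (n%:R).
Proof.
move=> n0; elim: k => [|k IH]; first by rewrite big_ord0 addn0 subrr.
have h : 0 < (n + k)%:R :> R by rewrite ltr0n addn_gt0 n0.
rewrite big_ord_recr /= addnS -natr1; have := ln_step h; lra.
Qed.

Lemma geo_sum_le x k : 0 <= x < 1 -> \sum_(i < k) x ^+ i <= (1 - x)^-1.
Proof.
move=> /andP[x0 x1]; have h : 0 < 1 - x by lra.
have H : (1 - x) * \sum_(i < k) x ^+ i = 1 - x ^+ k.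
  elim: k => [|k IH]; first by rewrite big_ord0 mulr0 subrr.
  by rewrite big_ord_recr /= mulrDr IH exprS; ring.
rewrite -[leRHS]mul1r ler_pdivlMr // mulrC H.
have : 0 <= x ^+ k by rewrite exprn_ge0.
lra.
Qed.

(** One contribution per range of heights: [1 + c] for heights up to about [1 / c], where the bound
    1 is used; the logarithm for the harmonic range up to about [1 / (1 - a)]; the last term for the
    geometric tail, through [gap a / (1 - a) = (1 + a) / a]. *)
Definition tooth_bound l : R :=
  let a := half_angle l in let c := gap l in
  1 + c + ln (c * ((1 - a)^-1 + 1) + c + 1) + 4 / 3 * ((1 + a) / a).

Lemma tooth_sum_le l n : 0 < l < 1 ->
  gap l * \sum_(y < n) tooth_hit l y.+1 <= tooth_bound l.
Proof.
move=> l01; have a01 := half_angle_itv l01; have /andP[a0 a1] := a01.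
have d0 := gap_gt0 a01; have c0 := gap_gt0 l01.
have h1a : 0 < 1 - half_angle l by lra.
rewrite /tooth_bound /=.
set a := half_angle l in a01 a0 a1 d0 h1a *; set c := gap l in c0 *.
set q := (Num.truncn c^-1).+1.
set k := (Num.truncn (1 - a)^-1).+1.
have ci0 : 0 < c^-1 by rewrite invr_gt0.
have ai0 : 0 < (1 - a)^-1 by rewrite invr_gt0.
have /andP[q1 q2] : c^-1 <= q%:R <= c^-1 + 1.
  by have /andP[h1 h2] := truncn_itv (ltW ci0); rewrite (ltW h2) /q -natr1 lerD2r.
have /andP[k1 k2] : (1 - a)^-1 <= k%:R <= (1 - a)^-1 + 1.
  by have /andP[h1 h2] := truncn_itv (ltW ai0); rewrite (ltW h2) /k -natr1 lerD2r.
have q0 : (0 < q)%N by [].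
clearbody q k.
have h0 i : 0 <= tooth_hit l i by exact: tooth_hit_ge0.
(* Lengthening the sum to [q + k + n] terms allows a cut into three blocks whatever the size of
   [n]. *)
apply: (@le_trans _ _ (c * \sum_(y < q + k + n) tooth_hit l y.+1)).
  rewrite ler_pM2l // addnC big_split_ord /= lerDl.
  by apply: sumr_ge0.
rewrite big_split_ord big_split_ord /= [leLHS]mulrDr [X in X + _ <= _]mulrDr.
have S1 : c * \sum_(i < q) tooth_hit l i.+1 <= 1 + c.
  apply: (@le_trans _ _ (c * q%:R)).
    rewrite ler_pM2l // -[X in _ <= X%:R]card_ord -sumr_const ler_sum // => i _.
    exact: tooth_hit_le1.
  have : c * q%:R <= c * (c^-1 + 1) by rewrite ler_pM2l.
  by rewrite mulrDr mulfV ?gt_eqF // mulr1.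
have S2 : c * \sum_(i < k) tooth_hit l (q + i).+1 <= ln (c * ((1 - a)^-1 + 1) + c + 1).
  apply: (@le_trans _ _ (ln ((q + k)%:R : R) - ln (q%:R))).
    apply: le_trans (harmonic_le k _) => //.
    rewrite mulr_sumr; apply: ler_sum => i _.
    have := tooth_hit_le_inv l01 (ltn0Sn (q + i)); rewrite -/c => H.
    have := ler_wpM2l (ltW c0) H.
    by rewrite mulVKf ?gt_eqF.
  have qk0 : 0 < (q + k)%:R :> R by rewrite ltr0n addn_gt0 q0.
  have qR0 : 0 < q%:R :> R by rewrite ltr0n.
  rewrite -ln_div ?posrE // ler_ln ?posrE ?divr_gt0 //; last first.
    have := mulr_gt0 c0 (addr_gt0 ai0 ltr01); lra.
  rewrite ler_pdivrMr // natrD.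
  have cq : 1 <= c * q%:R by rewrite mulrC -ler_pdivrMr // div1r.
  (* Since [1 <= c * q], the ratio [(q + k) / q] is at most [1 + c * k]. *)
  apply: (@le_trans _ _ ((c * q%:R) * ((1 - a)^-1 + 1) + q%:R)).
    rewrite [leRHS]addrC lerD2l; apply: le_trans k2 _.
    by rewrite ler_peMl // ltW // addr_gt0.
  have : 0 <= c * q%:R by lra.
  nra.
have S3 : c * \sum_(i < n) tooth_hit l (q + k + i).+1 <= 4 / 3 * ((1 + a) / a).
  apply: (@le_trans _ _ (\sum_(i < n) 4 / 3 * gap a * a ^+ i)).
    rewrite mulr_sumr; apply: ler_sum => i _.
    have := @tooth_hit_tail R l (q + k + i).+1 l01; rewrite -/a -/c => H.
    have {}H : tooth_hit l (q + k + i).+1 <= 4 / 3 * (gap a / c) * a ^+ (q + k + i).+1.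
      apply: H; rewrite -ler_pdivrMr // div1r; apply: le_trans k1 _.
      by rewrite ler_nat -addnS -addnA addnCA leq_addr.
    apply: (@le_trans _ _ (c * (4 / 3 * (gap a / c) * a ^+ (q + k + i).+1))).
      by rewrite ler_pM2l.
    have -> : c * (4 / 3 * (gap a / c) * a ^+ (q + k + i).+1) =
       4 / 3 * gap a * a ^+ (q + k + i).+1 by field; rewrite gt_eqF.
    rewrite ler_pM2l ?mulr_gt0 //; apply: ler_wiXn2l; rewrite ?(ltW a0) ?(ltW a1) //.
    by rewrite leqW // leq_addl.
  rewrite -mulr_sumr -mulrA ler_pM2l //.
  apply: (@le_trans _ _ (gap a * (1 - a)^-1)).
    by rewrite ler_pM2l // geo_sum_le // (ltW a0).
  by rewrite le_eqVlt /gap; apply/orP; left; apply/eqP; field; rewrite !gt_eqF.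
lra.
Qed.

(** The sum is stopped at [1 / (1 - a)], where the corrections [1 - a] inherited from [tooth_hit_ge]
    total at most 1. *)
Lemma tooth_sum_ge l : 0 < l < 1 -> exists n,
  ln ((1 - half_angle l)^-1 / (1 + (gap l)^-1)) - 1 <=
  gap l * \sum_(y < n) tooth_hit l y.+1.
Proof.
move=> l01; have a01 := half_angle_itv l01; have /andP[a0 a1] := a01.
have c0 := gap_gt0 l01.
have h1a : 0 < 1 - half_angle l by lra.
set a := half_angle l in a01 a0 a1 h1a *; set c := gap l in c0 *.
have ci0 : 0 < c^-1 by rewrite invr_gt0.
have ai0 : 0 < (1 - a)^-1 by rewrite invr_gt0.
have /andP[k1 k2] := truncn_itv (ltW ai0).
set k := Num.truncn _ in k1 k2.
exists k.
apply: (@le_trans _ _ (\sum_(i < k) ((i.+1%:R + c^-1)^-1 - (1 - a)))); last first.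
  rewrite mulr_sumr; apply: ler_sum => i _.
  have := @tooth_hit_ge R l i.+1 l01; rewrite -/a -/c => H.
  have {}H : c^-1 * (i.+1%:R + c^-1)^-1 - (1 - a) / c <= tooth_hit l i.+1.
    apply: H; rewrite -ler_pdivlMr // div1r; apply: le_trans k1.
    by rewrite ler_nat.
  have := ler_wpM2l (ltW c0) H.
  by rewrite mulrBr mulVKf ?gt_eqF // mulrCA mulfV ?gt_eqF // mulr1.
rewrite big_split /= sumr_const card_ord -mulr_natl.
have P : 0 < 1 + c^-1 by rewrite addr_gt0.
have kk : k%:R * - (1 - a) >= -1.
  rewrite mulrN lerN2 -ler_pdivlMr // div1r //.
apply: lerD => //.
apply: le_trans (harmonic_ge k ci0).
rewrite ln_div ?posrE // lerB // ler_ln ?posrE //.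
- by move: k2; rewrite -natr1; lra.
- by have := ler0n R k; lra.
Qed.

Definition tooth_sum l : R := limn (fun n => \sum_(y < n) tooth_hit l y.+1).

Lemma cvg_tooth_sum l : 0 < l < 1 ->
  \sum_(y < n) tooth_hit l y.+1 @[n --> \oo] --> tooth_sum l.
Proof.
move=> l01; apply: nondecreasing_is_cvgn.
  by apply/nondecreasing_seqP => n; rewrite big_ord_recr /= lerDl tooth_hit_ge0.
exists (tooth_bound l / gap l) => _ [N _ <-].
by rewrite ler_pdivlMr ?gap_gt0 // mulrC; exact: tooth_sum_le.
Qed.

(** The ratio of the two cut-offs [1 / (1 - a)] and [1 / gap l] is of order [1 / (1 - l)], whence
    the logarithm. A bounded error is enough, as it will be divided by a diverging logarithm. The
    value 21 is [3 + 15 + 3]: [gap l <= 2] for [1 + c], the crude [ln 16 <= 15], and the tail. *)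
Lemma tooth_sum_asymp l : 1 / 2 <= l < 1 ->
  `| gap l * tooth_sum l + ln (1 - l) | <= 21.
Proof.
move=> /andP[l2 l1]; have l01 : 0 < l < 1 by apply/andP; split; lra.
have l0 : 0 < l by lra.
have a01 := half_angle_itv l01; have /andP[a0 a1] := a01.
have c0 := gap_gt0 l01; have T := cvg_tooth_sum l01.
set e := 1 - l; have e0 : 0 < e by rewrite /e; lra.
have e2 : e <= 1 / 2 by rewrite /e; lra.
have le : l = 1 - e by rewrite /e; ring.
have ll : 0 < 1 + l ^+ 2 by have := sqr_ge0 l; lra.
have aE : (1 - half_angle l)^-1 = (1 + l ^+ 2) / e ^+ 2 by rewrite half_angleB // invf_div.
have cE : gap l = e * (1 + l) / l by rewrite /gap /e; field; rewrite gt_eqF.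
have ai : (half_angle l)^-1 = (1 + l ^+ 2) / (2 * l) by rewrite /half_angle invf_div.
have lne : ln e^-1 = - ln e by rewrite lnV ?posrE.
have up : gap l * tooth_sum l <= tooth_bound l.
  have TM : gap l * \sum_(y < n) tooth_hit l y.+1 @[n --> \oo] --> gap l * tooth_sum l.
    exact: cvgMl_tmp.
  by apply: (cvgr_to_le TM); apply: nearW => n; exact: tooth_sum_le.
have low : ln ((1 - half_angle l)^-1 / (1 + (gap l)^-1)) - 1 <= gap l * tooth_sum l.
  have [n0 H] := tooth_sum_ge l01; apply: le_trans H _; rewrite ler_pM2l //.
  apply: (cvgr_to_ge T); near=> n.
  have nn : (n0 <= n)%N by near: n; exact: nbhs_infty_ge.
  rewrite -(subnKC nn) big_split_ord /= lerDl.
  by apply: sumr_ge0 => i _; exact: tooth_hit_ge0.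
have low2 : - ln e <= ln ((1 - half_angle l)^-1 / (1 + (gap l)^-1)).
  rewrite -lne ler_ln ?posrE ?invr_gt0 //; last first.
    by rewrite divr_gt0 ?invr_gt0 ?subr_gt0 ?addr_gt0 ?invr_gt0.
  rewrite aE cE.
  have -> : (1 + l ^+ 2) / e ^+ 2 / (1 + (e * (1 + l) / l)^-1) =
     e^-1 * ((1 + l ^+ 2) * (1 + l) / (e * (1 + l) + l)).
    by field; rewrite !gt_eqF //; nra.
  rewrite ler_peMr ?invr_ge0 ?(ltW e0) // ler_pdivlMr ?mul1r; nra.
have up2 : tooth_bound l <= - ln e + 21.
  have c2 : gap l <= 2 by rewrite cE ler_pdivrMr //; nra.
  have B1 : 4 / 3 * ((1 + half_angle l) / half_angle l) <= 3.
    have -> : (1 + half_angle l) / half_angle l = (half_angle l)^-1 + 1.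
      by field; rewrite gt_eqF.
    rewrite ai.
    have : (1 + l ^+ 2) / (2 * l) <= 5 / 4 by rewrite ler_pdivrMr; nra.
    lra.
  have B2 : ln (gap l * ((1 - half_angle l)^-1 + 1) + gap l + 1) <= ln (16 / e).
    rewrite ler_ln ?posrE ?divr_gt0 //; last first.
      have ai0 : 0 < (1 - half_angle l)^-1 by rewrite invr_gt0 subr_gt0.
      have := mulr_gt0 c0 (addr_gt0 ai0 ltr01); lra.
    rewrite ler_pdivlMr // aE.
    have -> : (gap l * ((1 + l ^+ 2) / e ^+ 2 + 1) + gap l + 1) * e =
       (1 + l) * (1 + l ^+ 2) / l + (2 * gap l + 1) * e.
      by rewrite cE; field; rewrite !gt_eqF.
    have : (1 + l) * (1 + l ^+ 2) / l <= 8 by rewrite ler_pdivrMr //; nra.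
    nra.
  have B3 : ln (16 / e) <= 15 - ln e.
    rewrite ln_div ?posrE // lerD2r.
    have := @le_ln1Dx R 15; have -> : 1 + 15 = 16 :> R by ring.
    by apply; lra.
  rewrite /tooth_bound; lra.
rewrite ler_norml; lra.
Unshelve. all: by end_near. Qed.

End ToothSum.

(** * Behaviour of the generating function near 1 *)

Section SpineAsymptotics.
Variable R : realType.
Implicit Types (x l t : R) (n m : nat).

(** Inverse of [half_angle] on the open unit interval: the generating function of the first passage
    to a neighbour for the simple walk on the line. *)
Definition first_pass x : R := (1 - Num.sqrt (1 - x ^+ 2)) / x.

Definition spine_factor x : R := first_pass (first_pass x).

Definition comb_gf x : R :=
  let l := spine_factor x in (1 + l) / (1 - l) * (1 + 2 * tooth_sum l).

Lemma first_pass_itv x : 0 < x < 1 ->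
  0 < first_pass x < 1 /\ half_angle (first_pass x) = x.
Proof.
move=> /andP[x0 x1]; rewrite /half_angle /first_pass.
have q0 : 0 < 1 - x ^+ 2 by nra.
have r0 : 0 < Num.sqrt (1 - x ^+ 2) by rewrite sqrtr_gt0.
have r2 := sqr_sqrtr (ltW q0).
set r := Num.sqrt _ in r0 r2 *.
have r1 : r < 1 by nra.
split.
  by rewrite divr_gt0 ?subr_gt0 //= ltr_pdivrMr // mul1r; nra.
have -> : 1 + ((1 - r) / x) ^+ 2 = 2 * (1 - r) / x ^+ 2.
  have -> : 1 + ((1 - r) / x) ^+ 2 = (x ^+ 2 + (1 - r) ^+ 2) / x ^+ 2.
    by field; rewrite gt_eqF.
  by congr (_ / _); have : x ^+ 2 = 1 - r ^+ 2 by [lra|]; move=> ->; ring.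
by field; rewrite !gt_eqF // subr_gt0.
Qed.

Lemma cvg_first_pass (x : nat -> R) :
  x n @[n --> \oo] --> (1 : R) -> first_pass (x n) @[n --> \oo] --> (1 : R).
Proof.
move=> x1.
have -> : (1 : R) = (1 - Num.sqrt (1 - 1 * 1)) * 1^-1.
  by rewrite mulr1 subrr sqrtr0 subr0 invr1 mulr1.
apply: cvgM; last by apply: cvgV => //; exact: oner_neq0.
apply: cvgB; first exact: cvg_cst.
have K : 1 - x n ^+ 2 @[n --> \oo] --> (1 - 1 * 1 : R).
  by apply: cvgB; [exact: cvg_cst | under eq_fun do rewrite expr2; exact: cvgM].
exact: (cvg_comp _ _ K (@sqrt_continuous R _)).
Qed.

Lemma spine_factorP x : 0 < x < 1 ->
  0 < spine_factor x < 1 /\ half_angle (half_angle (spine_factor x)) = x.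
Proof.
move=> /first_pass_itv[a01 aE]; have [l01 lE] := first_pass_itv a01.
by rewrite /spine_factor lE.
Qed.

(** Each level of [half_angle] squares the distance to 1, hence the fourth power. When [z = e^(-t)]
    the left side is [e^t - 1], so this links [l] to [t] exactly. *)
Lemma inv_half_angleB1 l : 0 < l < 1 ->
  (half_angle (half_angle l))^-1 - 1 = (1 - l) ^+ 4 / (4 * l * (1 + l ^+ 2)).
Proof.
move=> l01; have /andP[l0 l1] := l01; have /andP[a0 a1] := half_angle_itv l01.
have P : 0 < 1 + l ^+ 2 by have := sqr_ge0 l; lra.
have -> : (half_angle (half_angle l))^-1 - 1 =
    (1 - half_angle l) ^+ 2 / (2 * half_angle l).
  rewrite {1}/half_angle invf_div; field; rewrite gt_eqF //.
by rewrite half_angleB // /half_angle; field; rewrite !gt_eqF.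
Qed.

Lemma expRB1_bounds t : 0 <= t -> t <= expR t - 1 <= t * expR t.
Proof.
move=> t0; have := expR_ge1Dx t; have := expR_ge1Dx (- t) => h1 h2.
apply/andP; split; first by lra.
have : expR t * (1 - t) <= expR t * expR (- t) by rewrite ler_wpM2l // expR_ge0.
by rewrite -expRD subrr expR0; lra.
Qed.

Variable t : nat -> R.
Hypothesis t0 : \forall n \near \oo, 0 < t n.
Hypothesis cvgt : t n @[n --> \oo] --> (0 : R).
Let l n := spine_factor (expR (- t n)).

Lemma near_spine_itv : \forall n \near \oo, 0 < l n < 1.
Proof.
near=> n; have tn : 0 < t n by near: n.
by have [] := @spine_factorP (expR (- t n)); rewrite // expR_gt0 expR_lt1 oppr_lt0.
Unshelve. all: by end_near. Qed.

Lemma cvg_expRt (c : R) : expR (c * t n) @[n --> \oo] --> (1 : R).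
Proof.
rewrite -expR0 -[X in expR X](mulr0 c).
have K : c * t n @[n --> \oo] --> c * 0 by exact: cvgMl_tmp.
exact: (cvg_comp _ _ K (@continuous_expR R _)).
Qed.

Lemma cvg_spine : l n @[n --> \oo] --> (1 : R).
Proof.
apply: cvg_first_pass; apply: cvg_first_pass.
by have := cvg_expRt (-1); under eq_fun do rewrite mulN1r.
Qed.

Lemma cvg_lnV_t : (ln (t n)^-1)^-1 @[n --> \oo] --> (0 : R).
Proof.
have K : ln (t n)^-1 @[n --> \oo] --> +oo.
  apply/cvgryPge => A; near=> n.
  have tn : 0 < t n by near: n.
  rewrite -[A]expRK ler_ln ?posrE ?expR_gt0 ?invr_gt0 //.
  rewrite -[leLHS]invrK lef_pV2 ?posrE ?invr_gt0 ?expR_gt0 //.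
  near: n; apply: (cvgr_le _ cvgt); by rewrite invr_gt0 expR_gt0.
have H : \forall n \near \oo, 0 < ln (t n)^-1.
  by move/cvgryPgt : K => /(_ 0).
by have /(_ _)/iffRL := gtr0_cvgV0 H; apply.
Unshelve. all: by end_near. Qed.

(** The 8 is the value of [4 l (1 + l^2)] at [l = 1]; the squeeze comes from
    [t <= e^t - 1 <= t e^t]. *)
Lemma cvg_ratio : (1 - l n) ^+ 4 / t n @[n --> \oo] --> (8 : R).
Proof.
have L : 4 * l n * (1 + l n * l n) @[n --> \oo] --> (4 * 1 * (1 + 1 * 1) : R).
  apply: cvgM; first by apply: cvgMl_tmp; exact: cvg_spine.
  by apply: cvgD; [exact: cvg_cst|apply: cvgM; exact: cvg_spine].
have L2 : 4 * l n * (1 + l n * l n) * expR (1 * t n) @[n --> \oo] -->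
    (4 * 1 * (1 + 1 * 1) * 1 : R).
  by apply: cvgM => //; exact: cvg_expRt.
have E8 : 4 * 1 * (1 + 1 * 1) = 8 :> R by ring.
rewrite mulr1 E8 in L2; rewrite E8 in L.
apply: (squeeze_cvgr _ L L2); near=> n.
have tn : 0 < t n by near: n.
have l01 : 0 < l n < 1 by near: n; exact: near_spine_itv.
have /andP[l0 l1] := l01.
have [_ zE] : 0 < l n < 1 /\ half_angle (half_angle (l n)) = expR (- t n).
  by apply: spine_factorP; rewrite expR_gt0 expR_lt1 oppr_lt0.
have := inv_half_angleB1 l01; rewrite zE -expRN opprK => E.
have P : 0 < 4 * l n * (1 + l n ^+ 2).
  by apply: mulr_gt0; [exact: mulr_gt0|rewrite ltr_pwDl ?sqr_ge0].
have {}E : (1 - l n) ^+ 4 = 4 * l n * (1 + l n ^+ 2) * (expR (t n) - 1).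
  by rewrite E mulrC divfK // gt_eqF.
rewrite E mul1r -expr2 ler_pdivlMr // ler_pdivrMr //.
have /andP[B1 B2] := expRB1_bounds (ltW tn).
rewrite ler_pM2l // B1 /= -[leRHS]mulrA ler_pM2l // mulrC //.
Unshelve. all: by end_near. Qed.

(** Logarithms of [cvg_ratio]: [4 ln (1 - l) - ln t] converges, and [ln t] diverges. *)
Lemma cvg_ln_ratio : - ln (1 - l n) / ln (t n)^-1 @[n --> \oo] --> (1 / 4 : R).
Proof.
have A : ln ((1 - l n) ^+ 4 / t n) @[n --> \oo] --> ln (8 : R).
  by apply: (cvg_comp _ _ cvg_ratio); exact: continuous_ln.
have B : (1 - ln ((1 - l n) ^+ 4 / t n) * (ln (t n)^-1)^-1) / 4 @[n --> \oo] -->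
   ((1 - ln 8 * 0) / 4 : R).
  apply: cvgMr_tmp; apply: cvgB; first exact: cvg_cst.
  by apply: cvgM => //; exact: cvg_lnV_t.
rewrite mulr0 subr0 in B.
apply: cvg_trans B; apply: near_eq_cvg; near=> n.
have tn : 0 < t n by near: n.
have t1 : t n < 1 by near: n; apply: (cvgr_lt _ cvgt).
have /andP[l0 l1] : 0 < l n < 1 by near: n; exact: near_spine_itv.
have lt0 : ln (t n) < 0 by rewrite ln_lt0 // tn.
rewrite ln_div ?posrE ?exprn_gt0 ?subr_gt0 // lnXn ?subr_gt0 // lnV ?posrE //.
by rewrite -mulr_natr; field; rewrite lt_eqF.
Unshelve. all: by end_near. Qed.

Lemma comb_gf_asymp :
  comb_gf (expR (- t n)) * Num.sqrt (t n) / ln (t n)^-1 @[n --> \oo] -->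
  ((Num.sqrt 8)^-1 / 2 : R).
Proof.
have cl := cvg_spine; have cV := cvg_lnV_t.
have l2 : \forall n \near \oo, 1 / 2 <= l n by apply: (cvgr_ge _ cl); lra.
have bnd : (gap (l n) * tooth_sum (l n) + ln (1 - l n)) * (ln (t n)^-1)^-1
    @[n --> \oo] --> (0 : R).
  have lo : - (21 * `|(ln (t n)^-1)^-1|) @[n --> \oo] --> (0 : R).
    rewrite -oppr0 -(mulr0 21) -[X in - (21 * X)](@normr0 R R).
    by apply: cvgN; apply: cvgMl_tmp; exact: cvg_norm.
  have hi : 21 * `|(ln (t n)^-1)^-1| @[n --> \oo] --> (0 : R).
    rewrite -(mulr0 21) -[X in (21 * X)](@normr0 R R).
    by apply: cvgMl_tmp; exact: cvg_norm.
  apply: (squeeze_cvgr _ lo hi); near=> n.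
  have /andP[l0 l1] : 0 < l n < 1 by near: n; exact: near_spine_itv.
  have lh : 1 / 2 <= l n by near: n.
  rewrite -ler_norml normrM ler_wpM2r // tooth_sum_asymp // lh //.
(* The square root is [sqrt t / (1 - l)^2]. The second factor is [(1 - l)^2] times [comb_gf], over
   the logarithm: it uses [(1 - l) (1 + l) = l * gap l] and splits [gap l * tooth_sum l] into a
   bounded part and [- ln (1 - l)]. *)
have main : Num.sqrt (((1 - l n) ^+ 4 / t n)^-1) *
   ((1 + l n) * (1 - l n) * (ln (t n)^-1)^-1
    + 2 * l n * ((gap (l n) * tooth_sum (l n) + ln (1 - l n)) * (ln (t n)^-1)^-1
    + - ln (1 - l n) / ln (t n)^-1)) @[n --> \oo] -->
   (Num.sqrt (8^-1) * ((1 + 1) * (1 - 1) * 0 + 2 * 1 * (0 + 1 / 4)) : R).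
  apply: cvgM.
    have K : ((1 - l n) ^+ 4 / t n)^-1 @[n --> \oo] --> (8^-1 : R).
      by apply: cvgV => //; exact: cvg_ratio.
    exact: (cvg_comp _ _ K (@sqrt_continuous R _)).
  apply: cvgD.
    apply: cvgM => //; apply: cvgM.
      by apply: cvgD => //; exact: cvg_cst.
    by apply: cvgB => //; exact: cvg_cst.
  apply: cvgM; first exact: cvgMl_tmp.
  by apply: cvgD => //; exact: cvg_ln_ratio.
have E : Num.sqrt (8^-1) * ((1 + 1) * (1 - 1) * 0 + 2 * 1 * (0 + 1 / 4)) =
    (Num.sqrt 8)^-1 / 2 :> R.
  by rewrite sqrtrV //; congr (_ * _); lra.
rewrite E in main.
apply: cvg_trans main; apply: near_eq_cvg; near=> n.
have tn : 0 < t n by near: n.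
have t1 : t n < 1 by near: n; apply: (cvgr_lt _ cvgt).
have /andP[l0 l1] : 0 < l n < 1 by near: n; exact: near_spine_itv.
have lt0 : 0 < ln (t n)^-1 by rewrite lnV ?posrE // oppr_gt0 ln_lt0 // tn.
have e0 : 0 < 1 - l n by lra.
rewrite invf_div sqrtrM ?(ltW tn) // sqrtrV ?exprn_ge0 ?(ltW e0) //.
have -> : (1 - l n) ^+ 4 = ((1 - l n) ^+ 2) ^+ 2 by ring.
rewrite sqrtr_sqr ger0_norm ?sqr_ge0 // /comb_gf -/(l n) /gap.
by field; rewrite !gt_eqF.
Unshelve. all: by end_near. Qed.

End SpineAsymptotics.

(** * First-step equations on the comb *)

Section CombFirstHit.
Variable R : realType.
Implicit Types (u v w : int * int) (f G : int * int -> R) (n k : nat).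

Definition nbrs u : seq (int * int) :=
  if u.2 == 0 then [:: (u.1 + 1, 0); (u.1 - 1, 0); (u.1, 1); (u.1, -1)]
  else [:: (u.1, u.2 + 1); (u.1, u.2 - 1)].

Definition step_avg f u : R := (\sum_(w <- nbrs u) f w) / (size (nbrs u))%:R.

(** Probability that the walk from [u] meets [v] for the first time at time [n], by recursion on the
    first step; [prob_hit_after] relates it to the walk. *)
Fixpoint first_hit v n u : R :=
  if n is m.+1 then if u == v then 0 else step_avg (first_hit v m) u
  else (u == v)%:R.

Lemma step_avg_spine f (x : int) :
  step_avg f (x, 0) = (f (x + 1, 0) + f (x - 1, 0) + f (x, 1) + f (x, -1)) / 4.
Proof. by rewrite /step_avg /nbrs /= !big_cons big_nil addr0 !addrA. Qed.

Lemma step_avg_tooth f (x y : int) : y != 0 ->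
  step_avg f (x, y) = (f (x, y + 1) + f (x, y - 1)) / 2.
Proof.
by move=> /negbTE y0; rewrite /step_avg /nbrs /= y0 !big_cons big_nil addr0.
Qed.

Lemma size_nbrs_gt0 u : 0 < (size (nbrs u))%:R :> R.
Proof. by rewrite ltr0n /nbrs; case: ifP. Qed.

Lemma norm_step_avg_le f u (C : R) : (forall w, `|f w| <= C) -> `|step_avg f u| <= C.
Proof.
move=> H; rewrite /step_avg normrM normfV normr_nat ler_pdivrMr ?size_nbrs_gt0 //.
apply: le_trans (ler_norm_sum _ _ _) _.
elim: (nbrs u) => [|w s IH]; first by rewrite big_nil mulr0.
by rewrite big_cons /= -natr1 mulrDr mulr1 addrC lerD.
Qed.

Lemma first_hit_bounds v n u : 0 <= first_hit v n u <= 1.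
Proof.
elim: n u => [|n IH] u /=; first by case: (_ == _); rewrite !(ler01, lexx).
case: (_ == _); first by rewrite lexx ler01.
apply/andP; split.
  rewrite divr_ge0 //; apply: sumr_ge0 => w _; by have /andP[] := IH w.
apply: le_trans (ler_norm _) _; apply: norm_step_avg_le => w.
by have /andP[h0 h1] := IH w; rewrite ger0_norm.
Qed.

(* A bounded solution of the first-step equations is unique, since the step
   contracts by the factor [z]. *)
Lemma first_hit_gf v G (z C : R) u : 0 <= z < 1 ->
  (forall w, `|G w| <= C) -> G v = 1 ->
  (forall w, w != v -> G w = z * step_avg G w) ->
  \sum_(n < N) first_hit v n u * z ^+ n @[N --> \oo] --> G u.
Proof.
move=> /andP[z0 z1] GC Gv Gstep.
have C0 : 0 <= C by exact: le_trans (normr_ge0 _) (GC v).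
have key N w : `|G w - \sum_(n < N) first_hit v n w * z ^+ n| <= C * z ^+ N.
  elim: N w => [|N IH] w; first by rewrite big_ord0 subr0 expr0 mulr1.
  rewrite big_ord_recl /= expr0 mulr1.
  have [->|wv] := eqVneq w v.
    rewrite big1; first by rewrite addr0 Gv subrr normr0 mulr_ge0 // exprn_ge0.
    by move=> i _; rewrite /= mul0r.
  rewrite add0r Gstep //.
  (* The partial sums obey the same first-step equation, with one term fewer on the right, so the
     error gains a factor [z] per term. *)
  have -> : \sum_(i < N) step_avg (first_hit v i) w * z ^+ bump 0 i =
     z * step_avg (fun w => \sum_(n < N) first_hit v n w * z ^+ n) w.
    rewrite /step_avg exchange_big /= mulr_suml mulr_sumr; apply: eq_bigr => i _.
    by rewrite -mulr_suml /bump add1n exprS; ring.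
  rewrite -mulrBr.
  have -> : step_avg G w - step_avg (fun w => \sum_(n < N) first_hit v n w * z ^+ n) w
     = step_avg (fun w => G w - \sum_(n < N) first_hit v n w * z ^+ n) w.
    by rewrite /step_avg -mulrBl -sumrB.
  rewrite normrM ger0_norm // exprS mulrCA ler_wpM2l //.
  exact: norm_step_avg_le.
have zc : C * z ^+ N @[N --> \oo] --> (0 : R).
  rewrite -(mulr0 C); apply: cvgMl_tmp; apply: cvg_expr; by rewrite ger0_norm.
apply/cvgrPdist_le => e e0; near=> N; apply: le_trans (key N u) _.
by near: N; apply: (cvgr_le _ zc).
Unshelve. all: by end_near. Qed.

(** Symmetry in the horizontal axis: the explicit solution need only treat targets at nonnegative
    height. *)
Lemma first_hit_reflect (x y : int) n (x1 y1 : int) :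
  first_hit (x, - y) n (x1, - y1) = first_hit (x, y) n (x1, y1).
Proof.
elim: n x1 y1 => [|n IH] x1 y1 /=; rewrite !xpair_eqE eqr_opp //.
case: ifP => // _.
have [->|y0] := eqVneq y1 0.
  by rewrite oppr0 !step_avg_spine -(IH x1 1) -(IH x1 (-1)) -!(IH _ 0) !oppr0 opprK; ring.
rewrite !step_avg_tooth ?oppr_eq0 // -(IH x1 (y1 + 1)) -(IH x1 (y1 - 1)).
by rewrite opprB opprD addrC [1 - y1]addrC.
Qed.

(** * Explicit solution of the first-step equations *)

Variable l : R.
Hypothesis l01 : 0 < l < 1.
Local Notation a := (half_angle l).
Local Notation z := (half_angle a).
Local Notation D := (tooth_den l).

Let l0 : 0 < l. Proof. by case/andP: l01. Qed.
Let a0 : 0 < a. Proof. by case/andP: (half_angle_itv l01). Qed.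
Let a1 : a < 1. Proof. by case/andP: (half_angle_itv l01). Qed.
Let l2 : 1 + l ^+ 2 != 0. Proof. by rewrite gt_eqF // ltr_pwDl ?sqr_ge0. Qed.

Let zE : z = 2 / (a + a^-1).
Proof.
have -> : a + a^-1 = (1 + a ^+ 2) / a by field; rewrite gt_eqF.
by rewrite invf_div mulrA.
Qed.

(** This is [z (a + 1/a) / 2 = 1], in a form that rewrites a multiple of a power of [a] as [z] times
    the mean of its two neighbours. *)
Lemma pow_tooth_rec (X : R) : X = z * ((a * X + a^-1 * X) / 2).
Proof.
rewrite zE; have : a + a^-1 != 0 by rewrite gt_eqF // addr_gt0 // invr_gt0.
rewrite -mulrDl => h; by rewrite mulrC mulrA divfK // mulrC mulKf.
Qed.

Lemma tooth_den_rec k : D k.+1 = z * ((D k.+2 + D k) / 2).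
Proof.
rewrite [LHS](pow_tooth_rec (D k.+1)); congr (_ * (_ / _)).
rewrite /tooth_den /= !exprS; field.
by rewrite expf_neq0 gt_eqF.
Qed.

Lemma tooth_den0 : D 0 = gap a.
Proof. by rewrite /tooth_den /= expr0 invr1 subrr mulr0 add0r mulr1. Qed.

Let al : a^-1 = (l + l^-1) / 2.
Proof. by rewrite /half_angle; field; rewrite l2 gt_eqF. Qed.

(** The equation at the foot of the target tooth: two spine neighbours, one step up towards the
    target, one step down the opposite tooth. It forces [D 1 / D 0 = gap l + a], which fixes the
    coefficients in [tooth_den]. *)
Lemma tooth_den_spine : D 0 = z * ((l * D 0 + l * D 0 + D 1%N + a * D 0) / 4).
Proof.
have D1 : D 1%N = D 0 * (gap l + a) by rewrite tooth_den0 /tooth_den /= expr1 /gap; ring.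
have -> : (l * D 0 + l * D 0 + D 1%N + a * D 0) / 4 = (a * D 0 + a^-1 * D 0) / 2.
  by rewrite D1 al /gap; field; rewrite gt_eqF.
exact: pow_tooth_rec.
Qed.

(** The equation at the foot of any other tooth, by [l + 1/l = 2/a]. *)
Lemma pow_spine_rec (X : R) : X = z * ((l * X + l^-1 * X + a * X + a * X) / 4).
Proof.
have -> : (l * X + l^-1 * X + a * X + a * X) / 4 = (a * X + a^-1 * X) / 2.
  by rewrite al; field; rewrite gt_eqF.
exact: pow_tooth_rec.
Qed.

(** Candidate values at starting points on the target tooth, the target being at height [k]. From
    above the target or from below the axis the walk must descend or climb one vertex at a time, at
    the cost of a factor [a] each; [Negz j] lies at depth [j.+1]. *)
Definition tooth_profile k (y : int) : R :=
  match y with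
  | Posz j => if (j <= k)%N then D j / D k else a ^+ (j - k)
  | Negz j => a ^+ j.+1 * tooth_hit l k
  end.

(** Elsewhere the path to the target must pass through the foot of its own tooth, then along the
    spine to column [x], then up: the factors multiply. *)
Definition hit_profile (x : int) k u : R :=
  if u.1 == x then tooth_profile k u.2
  else l ^+ `|u.1 - x|%N * (a ^+ `|u.2|%N * tooth_hit l k).

Let Dk k : D k != 0. Proof. by rewrite gt_eqF // tooth_den_gt0. Qed.

Lemma tooth_profile0 k : tooth_profile k 0 = tooth_hit l k.
Proof. by rewrite /= tooth_den0. Qed.

Lemma hit_profile_spine x k (x1 : int) :
  hit_profile x k (x1, 0) = l ^+ `|x1 - x|%N * tooth_hit l k.
Proof.
rewrite /hit_profile /=; case: eqP => [->|_]; last by rewrite expr0 mul1r.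
by rewrite subrr expr0 mul1r tooth_den0.
Qed.

Lemma tooth_profile_rec k (y : int) : y != 0 -> y != k ->
  tooth_profile k y = z * ((tooth_profile k (y + 1) + tooth_profile k (y - 1)) / 2).
Proof.
case: y => [[|j]|j] // _ yk.
  have -> : (Posz j.+1 + 1)%R = Posz j.+2 by lia.
  have -> : (Posz j.+1 - 1)%R = Posz j by lia.
  rewrite /tooth_profile; case: (ltngtP j.+1 k) => jk.
  - rewrite ?jk ?(ltnW jk) (ltnW (ltnW jk)).
    by rewrite {1}tooth_den_rec; field; exact: Dk.
  -
    (* The two branches of the profile agree at [j = k], so the geometric one also holds at the
       target. *)
    have E : (if (j <= k)%N then D j / D k else a ^+ (j - k)) = a ^+ (j - k).
      case: leqP => // jk'; have -> : j = k by lia.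
      by rewrite subnn mulfV.
    rewrite E (_ : (j.+2 - k = (j - k).+2)%N); last by lia.
    rewrite (_ : (j.+1 - k = (j - k).+1)%N); last by lia.
    rewrite {1}(pow_tooth_rec (a ^+ (j - k).+1)); congr (_ * ((_ + _) / _)).
    by rewrite exprS mulKf // gt_eqF.
  - by move/eqP: yk; rewrite jk.
have -> : (Negz j - 1)%R = Negz j.+1 by lia.
have E : tooth_profile k (Negz j + 1) = a ^+ j * tooth_hit l k.
  case: j {yk} => [|j].
    by rewrite (_ : (Negz 0 + 1)%R = 0) ?tooth_profile0 ?expr0 ?mul1r.
  by rewrite (_ : (Negz j.+1 + 1)%R = Negz j); last lia.
rewrite E /= {1}(pow_tooth_rec (a ^+ j.+1 * tooth_hit l k)) !exprS; field.
by rewrite gt_eqF.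
Qed.

Lemma hit_profile_rec x k w : w != (x, Posz k) ->
  hit_profile x k w = z * step_avg (hit_profile x k) w.
Proof.
case: w => x1 y1 ne.
have [y10|y10] := eqVneq y1 0; last first.
  rewrite step_avg_tooth // /hit_profile /=.
  case: eqP => [x1x|_].
    apply: tooth_profile_rec => //; move: ne; by rewrite xpair_eqE x1x eqxx.
  (* One vertical neighbour is nearer to the axis and one farther; the sign of [y1] only decides
     which. *)
  have [j [E1 E2]] : exists j, `|y1|%N = j.+1 /\
     ((`|(y1 + 1)%R|%N = j.+2 /\ `|(y1 - 1)%R|%N = j) \/
      (`|(y1 + 1)%R|%N = j /\ `|(y1 - 1)%R|%N = j.+2)).
    exists `|y1|.-1%N; split; first by lia.
    by case: (lerP 0 y1) => ?; [left|right]; lia.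
  set X := l ^+ _; set h := tooth_hit _ _.
  rewrite E1 {1}(pow_tooth_rec (X * (a ^+ j.+1 * h))).
  case: E2 => -[-> ->]; rewrite !exprS; field; by rewrite gt_eqF.
subst y1; rewrite step_avg_spine !hit_profile_spine.
have [x1x|x1x] := eqVneq x1 x.
  subst x1; rewrite /hit_profile /= eqxx subrr expr0 mul1r.
  have k0 : (0 < k)%N by move: ne; rewrite xpair_eqE eqxx /=; case: (k).
  rewrite k0 (_ : `|(x + 1 - x)%R|%N = 1%N); last by lia.
  rewrite (_ : `|(x - 1 - x)%R|%N = 1%N); last by lia.
  rewrite !expr1 /tooth_hit -tooth_den0 {1}tooth_den_spine; field; exact: Dk.
rewrite /hit_profile /= (negbTE x1x) !expr1.
have [j [E1 E2]] : exists j, `|(x1 - x)%R|%N = j.+1 /\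
   ((`|(x1 + 1 - x)%R|%N = j.+2 /\ `|(x1 - 1 - x)%R|%N = j) \/
    (`|(x1 + 1 - x)%R|%N = j /\ `|(x1 - 1 - x)%R|%N = j.+2)).
  exists `|(x1 - x)%R|.-1%N; split; first by lia.
  by case: (lerP 0 (x1 - x)) => ?; [left|right]; lia.
set h := tooth_hit _ _.
rewrite E1 {1}(pow_spine_rec (l ^+ j.+1 * h)).
case: E2 => -[-> ->]; rewrite !exprS; field; by rewrite gt_eqF.
Qed.

(** Uniqueness asks for some bound uniform in [w]; summing the nonnegative ratios dominates each of
    them without studying the monotonicity of [D]. *)
Lemma norm_hit_profile_le x k w :
  `|hit_profile x k w| <= 1 + \sum_(j < k.+1) D j / D k.
Proof.
have h0 : 0 <= tooth_hit l k by exact: tooth_hit_ge0.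
have h1 : tooth_hit l k <= 1 by exact: tooth_hit_le1.
have l1 : l <= 1 by case/andP: l01 => _ /ltW.
have pa j : 0 <= a ^+ j <= 1 by rewrite exprn_ge0 ?exprn_ile1 // ltW.
have pl j : 0 <= l ^+ j <= 1 by rewrite exprn_ge0 ?exprn_ile1 // ltW.
have T j : 0 <= D j / D k by rewrite divr_ge0 // ltW // tooth_den_gt0.
have S0 : 0 <= \sum_(j < k.+1) D j / D k by exact: sumr_ge0.
have ah j : 0 <= a ^+ j * tooth_hit l k <= 1.
  by have /andP[p0 p1] := pa j; rewrite mulr_ge0 //= mulr_ile1.
suff /andP[g0 g1] : 0 <= hit_profile x k w <= 1 + \sum_(j < k.+1) D j / D k.
  by rewrite ger0_norm.
rewrite /hit_profile; case: eqP => _; last first.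
  have /andP[p0 p1] := pl `|w.1 - x|%N; have /andP[q0 q1] := ah `|w.2|%N.
  rewrite mulr_ge0 //=; apply: (@le_trans _ _ 1); last by rewrite lerDl.
  by rewrite mulr_ile1.
rewrite /tooth_profile; case: w.2 => j; last first.
  by have /andP[-> q1] := ah j.+1; rewrite /= (le_trans q1) // lerDl.
case: leqP => jk; last first.
  by have /andP[-> q1] := pa (j - k)%N; rewrite /= (le_trans q1) // lerDl.
rewrite T /=; have jk' : (j < k.+1)%N by [].
rewrite (bigD1 (Ordinal jk')) //= addrCA lerDl addr_ge0 //.
exact: sumr_ge0.
Qed.

Lemma first_hit_gf_origin v :
  \sum_(n < N) first_hit v n (0, 0) * z ^+ n @[N --> \oo] -->
  l ^+ `|v.1|%N * tooth_hit l `|v.2|%N.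
Proof.
have pos (x : int) k : \sum_(n < N) first_hit (x, Posz k) n (0, 0) * z ^+ n
    @[N --> \oo] --> l ^+ `|x|%N * tooth_hit l k.
  rewrite (_ : `|x|%N = `|(0 - x)%R|%N); last by lia.
  rewrite -hit_profile_spine.
  apply: first_hit_gf.
  - by apply/andP; split; [apply: ltW|]; case/andP: (half_angle_itv (half_angle_itv l01)).
  - exact: norm_hit_profile_le.
  - by rewrite /hit_profile /= eqxx leqnn mulfV.
  - exact: hit_profile_rec.
case: v => x y /=; case: (intP y) => [|k|k]; [exact: pos|exact: pos|].
have -> : `|- (k.+1%:Z)|%N = k.+1 by rewrite abszN.
have := pos x k.+1; apply: cvg_trans; apply: near_eq_cvg; apply: nearW => N.
by apply: eq_bigr => n _; rewrite -[X in _ = first_hit _ n (_, X) * _]oppr0 first_hit_reflect.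
Qed.

End CombFirstHit.

(** * Neighbours and degrees in the comb *)

Section CombGraph.
Variable R : realType.
Implicit Types (u v w : int * int).

Lemma sqr_int_sum_eq1 (a b : int) : (a ^+ 2 + b ^+ 2 == 1) =
  ((a == 0) && ((b == 1) || (b == -1)) || (b == 0) && ((a == 1) || (a == -1))).
Proof.
apply/idP/idP => [/eqP E|].
  have ha : (-1 <= a <= 1)%R by apply/andP; split; nia.
  have hb : (-1 <= b <= 1)%R by apply/andP; split; nia.
  have ca : a = 0 \/ (a = 1 \/ a = -1) by lia.
  have cb : b = 0 \/ (b = 1 \/ b = -1) by lia.
  by move: E; case: ca => [->|[]->]; case: cb => [->|[]->].
by case/orP => /andP[/eqP-> /orP[]/eqP->].
Qed.

Lemma comb_adjE u w : comb_adj u w = (w \in nbrs u).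
Proof.
case: u w => [u1 u2] [w1 w2]; rewrite /comb_adj /grid_adj /nbrs sqr_int_sum_eq1 /=.
case: ifP => h; rewrite !inE !xpair_eqE; lia.
Qed.

Lemma nbrs_uniq u : uniq (nbrs u).
Proof.
by case: u => x y; rewrite /nbrs /=; case: ifP => _; rewrite /= !inE !xpair_eqE; lia.
Qed.

Lemma comb_degree u : degree comb_adj u = size (nbrs u).
Proof.
rewrite /degree.
have -> : [set w | comb_adj u w] = [set` [fset w in nbrs u]%fset].
  by apply/seteqP; split => w /=; rewrite comb_adjE inE.
by rewrite set_fsetK card_fseq undup_id // nbrs_uniq.
Qed.

Lemma comb_step_prob u w : step_prob R comb_adj u w =
  (w \in nbrs u)%:R / (size (nbrs u))%:R.
Proof.
rewrite /step_prob comb_adjE comb_degree.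
by case: (_ \in _); rewrite ?mul1r ?mul0r.
Qed.

End CombGraph.

(** * Probabilities of new vertices *)

Section CombWalk.
Variables (R : realType) (d : measure_display) (T : measurableType d).
Variables (P : probability T R) (W : nat -> T -> int * int).
Hypothesis hW : simple_random_walk P comb_adj (0, 0) W.
Implicit Types (A B : set T) (v w : int * int) (m n k : nat).

Definition prob A : R := fine (P A).

Lemma probE A : measurable A -> P A = (prob A)%:E.
Proof. by move=> mA; rewrite /prob fineK // fin_num_measure. Qed.

Lemma prob_ge0 A : 0 <= prob A.
Proof. by rewrite fine_ge0. Qed.

Lemma probU A B : measurable A -> measurable B -> A `&` B = set0 ->
  prob (A `|` B) = prob A + prob B.
Proof.
move=> mA mB AB; apply: EFin_inj; rewrite EFinD -!probE //; last exact: measurableU.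
exact: measureU.
Qed.

Lemma prob_le A B : measurable A -> measurable B -> A `<=` B -> prob A <= prob B.
Proof.
by move=> mA mB AB; rewrite -lee_fin -!probE // le_measure // inE.
Qed.

Lemma prob_split A B : measurable A -> measurable B ->
  prob A = prob (A `&` B) + prob (A `&` ~` B).
Proof.
move=> mA mB; rewrite -probU.
- by rewrite -setIUr setUv setIT.
- exact: measurableI.
- by apply: measurableI => //; exact: measurableC.
- by rewrite setIACA setICr setI0.
Qed.

Lemma prob_setI0 A B : measurable A -> measurable B -> prob B = 0 -> prob (A `&` B) = 0.
Proof.
move=> mA mB B0; apply/eqP; rewrite eq_le prob_ge0 andbT -B0.
apply: prob_le => //; first exact: measurableI.
Qed.

Lemma measurable_pos k (S : set (int * int)) : measurable [set t | S (W k t)].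
Proof. exact: (srw_measurable hW). Qed.

Lemma measurable_forall (F : nat -> set T) n : (forall k, measurable (F k)) ->
  measurable [set t | forall k, (k < n)%N -> F k t].
Proof.
move=> mF.
exact: (@bigcap_measurableType _ _ F (fun k => (k < n)%N : Prop) (fun k _ => mF k)).
Qed.

Lemma prob_pos_in A k (s : seq (int * int)) : measurable A -> uniq s ->
  prob (A `&` [set t | W k t \in s]) =
  \sum_(w <- s) prob (A `&` [set t | W k t = w]).
Proof.
move=> mA; elim: s => [|w s IH] /= us.
  rewrite big_nil (_ : _ `&` _ = set0) /prob ?measure0 //.
  by apply/seteqP; split => t // [].
case/andP: us => ws us; rewrite big_cons -IH // -probU.
- congr prob; rewrite -setIUr; congr (_ `&` _); apply/seteqP; split => t /=.
    by rewrite inE => /orP[/eqP|]; [left|right].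
  by rewrite inE => -[->|->]; rewrite ?eqxx ?orbT.
- by apply: measurableI => //; exact: (measurable_pos k [set w]).
- by apply: measurableI => //; exact: (measurable_pos k [set` s]).
- apply/seteqP; split => t //= -[[_ E] [_ h]]; by rewrite -E h in ws.
Qed.

Definition cylinder m (x : nat -> int * int) : set T :=
  [set t | forall k, (k <= m)%N -> W k t = x k].

Definition hit_after m n v : set T :=
  [set t | W (m + n)%N t = v /\ forall k, (k < n)%N -> W (m + k)%N t <> v].

Lemma measurable_cylinder m x : measurable (cylinder m x).
Proof.
apply: (@measurable_forall (fun k => [set t | W k t = x k]) m.+1) => k.
exact: (measurable_pos k [set x k]).
Qed.

Lemma measurable_hit_after m n v : measurable (hit_after m n v).
Proof.
apply: measurableI; first exact: (measurable_pos _ [set v]).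
apply: (@measurable_forall (fun k => [set t | W (m + k)%N t <> v])) => k.
exact: (measurable_pos _ [set u | u <> v]).
Qed.

Lemma hit_afterS m n v : hit_after m n.+1 v =
  [set t | W m t <> v] `&` hit_after m.+1 n v.
Proof.
apply/seteqP; split => t; rewrite /hit_after /= addSnnS.
  move=> [h1 h2]; split; first by have := h2 0%N isT; rewrite addn0.
  by split=> // k kn; rewrite addSnnS; exact: h2.
move=> [h0 [h1 h2]]; split=> // -[|k] kn; first by rewrite addn0.
by rewrite -addSnnS; exact: h2.
Qed.

Definition extend m (x : nat -> int * int) w k := if (k <= m)%N then x k else w.

Lemma cylinder_extend m x w :
  cylinder m.+1 (extend m x w) = cylinder m x `&` [set t | W m.+1 t = w].
Proof.
apply/seteqP; split => t; rewrite /cylinder /extend /=.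
  move=> h; split; last by rewrite h // ltnn.
  by move=> k km; rewrite h ?km // leqW.
by move=> [h1 h2] k; rewrite leq_eqVlt ltnS => /orP[/eqP->|km];
   [rewrite ltnn|rewrite km h1].
Qed.

Lemma prob_cylinder_extend m x w :
  prob (cylinder m.+1 (extend m x w)) =
  prob (cylinder m x) * ((w \in nbrs (x m))%:R / (size (nbrs (x m)))%:R).
Proof.
apply: EFin_inj; rewrite EFinM -!probE; try exact: measurable_cylinder.
rewrite -comb_step_prob -(srw_step hW m x w) cylinder_extend.
by congr (P _); apply/seteqP; split.
Qed.

(** The transitions to neighbours already exhaust the mass of the cylinder. *)
Lemma prob_leave_nbrs m x :
  prob (cylinder m x `&` [set t | W m.+1 t \notin nbrs (x m)]) = 0.
Proof.
have mC := measurable_cylinder m x.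
have := prob_split mC (measurable_pos m.+1 [set` nbrs (x m)]).
rewrite (prob_pos_in _ mC (nbrs_uniq _)).
have -> : \sum_(w <- nbrs (x m)) prob (cylinder m x `&` [set t | W m.+1 t = w]) =
    prob (cylinder m x).
  under eq_big_seq => w wn do rewrite -cylinder_extend prob_cylinder_extend wn mul1r.
  rewrite big_const_seq count_predT iter_addr_0 -[LHS]mulr_natr divfK //.
  by rewrite gt_eqF // size_nbrs_gt0.
rewrite (_ : ~` _ = [set t | W m.+1 t \notin nbrs (x m)]).
  by move/esym/eqP; rewrite addrC -subr_eq0 addrK => /eqP.
by apply/seteqP; split => t /= /negP.
Qed.

(** The Markov property, proved by extending the prescribed trajectory by one step; [m] and [x] must
    vary in the induction. *)
Lemma prob_hit_after n m x v :
  prob (cylinder m x `&` hit_after m n v) =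
  prob (cylinder m x) * first_hit R v n (x m).
Proof.
elim: n m x => [|n IH] m x /=.
  case: eqP => [E|NE]; rewrite ?mulr1 ?mulr0.
    congr prob; apply/seteqP; split => t /=; first by case.
    by move=> h; split=> //; split => //; rewrite addn0 h.
  rewrite (_ : _ `&` _ = set0) /prob ?measure0 //.
  by apply/seteqP; split => t //= -[h [+ _]]; rewrite addn0 h.
case: eqP => [E|NE].
  rewrite mulr0 hit_afterS (_ : _ `&` _ = set0) /prob ?measure0 //.
  by apply/seteqP; split => t //= -[h [+ _]]; rewrite h.
have mC := measurable_cylinder m x; have mH := measurable_hit_after m.+1 n v.
have -> : cylinder m x `&` hit_after m n.+1 v = cylinder m x `&` hit_after m.+1 n v.
  rewrite hit_afterS; apply/seteqP; split => t /=; first by case=> ? [].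
  by move=> [h1 h2]; split=> //; split=> //; rewrite h1.
rewrite (prob_split (measurableI _ _ mC mH) (measurable_pos m.+1 [set` nbrs (x m)])).
rewrite [X in _ + X](_ : _ = 0) ?addr0; last first.
  rewrite setIAC (setIC (_ `&` ~` _)); apply: prob_setI0 => //.
    apply: measurableI => //; apply: measurableC.
    exact: (measurable_pos m.+1 [set` nbrs (x m)]).
  rewrite -[RHS](prob_leave_nbrs m x); congr (prob (_ `&` _)).
  by apply/seteqP; split => t /= /negP.
rewrite (prob_pos_in _ (measurableI _ _ mC mH) (nbrs_uniq _)).
rewrite /step_avg mulr_suml mulr_sumr; apply: eq_big_seq => w wn.
rewrite setIAC -cylinder_extend IH prob_cylinder_extend wn mul1r /extend ltnn.
by ring.
Qed.

Lemma prob_first_hit n v : prob (hit_after 0 n v) = first_hit R v n (0, 0).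
Proof.
set x : nat -> int * int := fun=> (0, 0).
have mC := measurable_cylinder 0 x; have mH := measurable_hit_after 0 n v.
(* The walk starts at the origin only almost surely, so the complement of this cylinder is discarded
   as a null event. *)
have C1 : prob (cylinder 0 x) = 1.
  apply: EFin_inj; rewrite -probE // -(srw_start hW); congr (P _).
  apply/seteqP; split => t /=; first by move=> /(_ 0%N isT).
  by move=> h k; rewrite leqn0 => /eqP->.
have C0 : prob (~` cylinder 0 x) = 0.
  have := prob_split measurableT mC; rewrite !setTI C1.
  have -> : prob setT = 1 by rewrite /prob probability_setT.
  lra.
rewrite (prob_split mH mC) [X in _ + X]prob_setI0 ?addr0 //; last exact: measurableC.
by rewrite setIC prob_hit_after C1 mul1r.
Qed.

Definition new_at n : set T := [set t | forall k, (k < n)%N -> W k t <> W n t].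

Lemma measurable_new_at n : measurable (new_at n).
Proof.
apply: (@measurable_forall (fun k => [set t | W k t <> W n t])) => k.
(* The event compares two random positions; fixing the earlier one gives a countable union of events
   about single positions. *)
rewrite (_ : [set t | _] = \bigcup_v ([set t | W k t = v] `&` [set t | v <> W n t])).
  apply: countable_bigcupT_measurable => [|v]; first exact: countableP.
  apply: measurableI; first exact: (measurable_pos _ [set v]).
  exact: (measurable_pos _ [set u | v <> u]).
apply/seteqP; split => t /=; first by move=> h; exists (W k t).
by move=> [v _ [-> ]].
Qed.

Lemma prob_new_at_in n (s : seq (int * int)) : uniq s ->
  prob (new_at n `&` [set t | W n t \in s]) =
  \sum_(v <- s) first_hit R v n (0, 0).
Proof.
move=> us; rewrite prob_pos_in //; last exact: measurable_new_at.
apply: eq_bigr => v _; rewrite -prob_first_hit; congr prob.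
apply/seteqP; split => t; rewrite /new_at /hit_after /= add0n.
  by move=> [h <-]; split=> // k kn; rewrite add0n; exact: h.
by move=> [<- h]; split=> // k kn; rewrite -(add0n k); exact: h.
Qed.

Lemma visitedE n t : visited W n t = (\sum_(k < n.+1) (t \in new_at k))%N.
Proof.
rewrite /visited; elim: n => [|n IH].
  by rewrite big_ord1 /= mem_set // => k.
have -> : iota 0 n.+2 = rcons (iota 0 n.+1) n.+1.
  by rewrite -[n.+2]addn1 iotaD cats1.
rewrite map_rcons big_ord_recr.
change (size (undup (rcons [seq W k t | k <- iota 0 n.+1] (W n.+1 t))) =
  (\sum_(k < n.+1) (t \in new_at k) + (t \in new_at n.+1))%N).
rewrite -IH.
set s := [seq _ | _ <- _].
(* Moving the newest vertex to the front lets [undup] test it against all earlier ones. *)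
have -> : size (undup (rcons s (W n.+1 t))) = size (undup (W n.+1 t :: s)).
  by apply: perm_size; apply: perm_undup; apply: perm_mem; rewrite perm_rcons.
have -> : (t \in new_at n.+1) = (W n.+1 t \notin s).
  apply/idP/idP; rewrite inE.
    move=> h; apply/negP => /mapP[k]; rewrite mem_iota add0n => /andP[_ kn] E.
    exact: (h k kn (esym E)).
  move=> h k kn E; move/negP: h; apply; rewrite -E; apply: map_f.
  by rewrite mem_iota.
by rewrite /=; case: (_ \in s); rewrite /= ?addn0 ?addn1.
Qed.

Lemma expectation_visited n :
  'E_P[fun t => (visited W n t)%:R]%E = (\sum_(k < n.+1) prob (new_at k))%:E.
Proof.
rewrite unlock.
have E t : ((visited W n t)%:R : R)%:E = (\sum_(k < n.+1) (\1_(new_at k) t)%:E)%E.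
  rewrite visitedE natr_sum sumEFin; congr (_%:E).
under eq_integral do rewrite E.
rewrite ge0_integral_sum //.
- rewrite -sumEFin; apply: eq_bigr => k _.
  by rewrite integral_indic // ?setIT -?probE //; exact: measurable_new_at.
- move=> k; apply/measurable_EFinP; apply: measurable_indic; exact: measurable_new_at.
Qed.

End CombWalk.

(** * Summation over all vertices *)

Section VisitGf.
Variables (R : realType) (d : measure_display) (T : measurableType d).
Variables (P : probability T R) (W : nat -> T -> int * int).
Hypothesis hW : simple_random_walk P comb_adj (0, 0) W.
Implicit Types (M n k : nat).

Definition int_range M : seq int :=
  [seq Posz i | i <- iota 0 M.+1] ++ [seq Negz i | i <- iota 0 M].

Definition box M : seq (int * int) :=
  [seq (x, y) | x <- int_range M, y <- int_range M].

Lemma mem_int_range M (x : int) : (x \in int_range M) = (`|x| <= M)%N.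
Proof.
rewrite mem_cat; case: x => i.
  rewrite mem_map ?mem_iota /=; last by move=> ? ? [].
  rewrite [X in _ || X](_ : _ = false) ?orbF ?ltnS //.
  by apply/negP => /mapP[].
rewrite [X in X || _](_ : _ = false) /=; last by apply/negP => /mapP[].
by rewrite mem_map ?mem_iota /= ?add0n // => ? ? [].
Qed.

Lemma int_range_uniq M : uniq (int_range M).
Proof.
rewrite cat_uniq !map_inj_uniq ?iota_uniq //= ?andbT; try by move=> ? ? [].
by apply/hasPn => x /mapP[i _ ->]; apply/negP => /mapP[].
Qed.

Lemma box_uniq M : uniq (box M).
Proof. by apply: allpairs_uniq; rewrite ?int_range_uniq // => -[? ?] [? ?]. Qed.

Lemma mem_box M (v : int * int) : (v \in box M) = (maxn `|v.1| `|v.2| <= M)%N.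
Proof.
case: v => x y; rewrite geq_max -!mem_int_range /=.
apply/idP/idP; first by move=> /allpairsP[[u w]] /= [h1 h2 [-> ->]]; rewrite h1.
by move=> /andP[h1 h2]; apply/allpairsP; exists (x, y).
Qed.

Lemma sum_int_range (f : nat -> R) M :
  \sum_(x <- int_range M) f `|x|%N = f 0%N + 2 * \sum_(i < M) f i.+1.
Proof.
have i0 : iota 0 M = index_iota 0 M by rewrite /index_iota subn0.
have i1 : iota 1 M = index_iota 1 M.+1 by rewrite /index_iota subn1.
rewrite big_cat !big_map /= big_cons i1 big_add1 i0 !big_mkord /=; ring.
Qed.

Lemma cvg_box_sum (l : R) : 0 < l < 1 ->
  \sum_(v <- box M) l ^+ `|v.1|%N * tooth_hit l `|v.2|%N @[M --> \oo] -->
  (1 + l) / (1 - l) * (1 + 2 * tooth_sum l).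
Proof.
move=> l01; have /andP[l0 l1] := l01.
have -> : (fun M => \sum_(v <- box M) l ^+ `|v.1|%N * tooth_hit l `|v.2|%N) =
  (fun M => (1 + 2 * \sum_(i < M) l ^+ i.+1) * (1 + 2 * \sum_(i < M) tooth_hit l i.+1)).
  apply/funext => M; rewrite big_allpairs /=.
  under eq_bigr do rewrite -mulr_sumr sum_int_range.
  rewrite -mulr_suml (sum_int_range (fun i => l ^+ i)) expr0.
  suff -> : tooth_hit l 0 = 1 by [].
  rewrite /tooth_hit tooth_den0 // mulfV // gt_eqF // gap_gt0 //; exact: half_angle_itv.
have -> : (1 + l) / (1 - l) = 1 + 2 * (l * (1 - l)^-1) by field; lra.
apply: cvgM; apply: cvgD; try exact: cvg_cst; apply: cvgMl_tmp.
  under eq_fun do under eq_bigr do rewrite exprS.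
  under eq_fun do rewrite -mulr_sumr.
  apply: cvgMl_tmp.
  have := @cvg_geometric_series R 1 l; rewrite div1r ger0_norm ?(ltW l0) // => /(_ l1).
  by apply: cvg_trans; apply: near_eq_cvg; apply: nearW => N;
    rewrite /series /= big_mkord; apply: eq_bigr => i _; rewrite /geometric /= mul1r.
exact: cvg_tooth_sum.
Qed.

(** Continuity of the measure along increasing events, as the boxes exhaust the plane. *)
Lemma cvg_prob_new_at_box n :
  \sum_(v <- box M) first_hit R v n (0, 0) @[M --> \oo] --> prob P (new_at W n).
Proof.
under eq_fun do rewrite -(prob_new_at_in hW) ?box_uniq //.
pose F M := new_at W n `&` [set t | W n t \in box M].
have mF M : measurable (F M).
  apply: measurableI; first exact: (measurable_new_at hW).
  exact: (measurable_pos hW n [set` box M]).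
have FE : \bigcup_M F M = new_at W n.
  apply/seteqP; split => t; first by move=> [M _ []].
  move=> h; exists (maxn `|(W n t).1| `|(W n t).2|) => //; split => //=.
  by rewrite mem_box.
have mN : measurable (\bigcup_M F M) by rewrite FE; exact: (measurable_new_at hW).
have Fmono : {homo F : M M' / (M <= M')%N >-> (M <= M')%O}.
  move=> M M' MM'; apply/subsetPset => t [h1 /= h2]; split=> //=.
  by move: h2; rewrite !mem_box => /leq_trans; apply.
have H := @nondecreasing_cvg_mu _ _ _ P F mF mN Fmono.
have E := probE P (measurable_new_at hW n).
by apply: (@fine_cvg _ _ _ _ (P \o F)); rewrite -E -FE.
Qed.

(** Interchange of the sums over vertices and over times. All terms are nonnegative: a truncation in
    time, with the box growing, gives one inequality, and a fixed box, with time growing, gives the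
    other. *)
Lemma new_at_gf (x : R) : 0 < x < 1 ->
  \sum_(k < N) prob P (new_at W k) * x ^+ k @[N --> \oo] --> comb_gf x.
Proof.
move=> x01; have /andP[x0 x1] := x01.
have [l01 lE] := spine_factorP x01.
set S := fun N => _; set a := fun k => prob P (new_at W k).
pose b M k : R := \sum_(v <- box M) first_hit R v k (0, 0).
pose g M : R := \sum_(v <- box M)
  spine_factor x ^+ `|v.1|%N * tooth_hit (spine_factor x) `|v.2|%N.
have gG : g M @[M --> \oo] --> comb_gf x by exact: cvg_box_sum.
have bg M : \sum_(k < N) b M k * x ^+ k @[N --> \oo] --> g M.
  have -> : (fun N => \sum_(k < N) b M k * x ^+ k) =
     (fun N => \sum_(v <- box M) \sum_(k < N) first_hit R v k (0, 0) * x ^+ k).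
    apply/funext => N; rewrite exchange_big; apply: eq_bigr => k _.
    by rewrite mulr_suml.
  rewrite /g; elim: (box M) => [|v s IH].
    by rewrite big_nil; under eq_fun do rewrite big_nil; exact: cvg_cst.
  rewrite big_cons; under eq_fun do rewrite big_cons.
  by apply: cvgD => //; rewrite -{1}lE; exact: first_hit_gf_origin.
have b0 M k : 0 <= b M k.
  by apply: sumr_ge0 => v _; have /andP[] := first_hit_bounds R v k (0, 0).
have ba M k : b M k <= a k.
  rewrite /b -(prob_new_at_in hW) ?box_uniq //.
  have m1 := measurable_new_at hW k.
  apply: prob_le => //; apply: measurableI => //.
  exact: (measurable_pos hW k [set` box M]).
have a0 k : 0 <= a k by exact: prob_ge0.
have X0 k : 0 <= x ^+ k by rewrite exprn_ge0 // ltW.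
have SG N : S N <= comb_gf x.
  have L : \sum_(k < N) b M k * x ^+ k @[M --> \oo] --> S N.
    by apply: cvg_sum_ord => k; apply: cvgMr_tmp; exact: cvg_prob_new_at_box.
  apply: (ler_cvg_to L gG); apply: nearW => M.
  apply: (cvgr_to_ge (bg M)); near=> N'.
  have NN : (N <= N')%N by near: N'; exact: nbhs_infty_ge.
  rewrite -(subnKC NN) big_split_ord /= lerDl.
  by apply: sumr_ge0 => i _; rewrite mulr_ge0.
have Scvg : S @ \oo --> limn S.
  apply: nondecreasing_is_cvgn.
    by apply/nondecreasing_seqP => n; rewrite /S big_ord_recr /= lerDl mulr_ge0 ?a0.
  by exists (comb_gf x) => _ [N _ <-].
suff <- : limn S = comb_gf x by [].
apply/eqP; rewrite eq_le; apply/andP; split.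
  by apply: (cvgr_to_le Scvg); exact: nearW.
apply: (cvgr_to_le gG); apply: nearW => M.
apply: (ler_cvg_to (bg M) Scvg); apply: nearW => N.
by apply: ler_sum => k _; rewrite ler_wpM2r ?ba.
Unshelve. all: by end_near. Qed.

End VisitGf.

(** * Conclusion *)

Section Normalisation.
Variable R : realType.
Implicit Types (n m : nat).

Lemma near_gt1 : \forall n \near \oo, (1 < n)%N.
Proof. exact: nbhs_infty_gt. Qed.

Lemma cvg_div_nat m : (m%:R / n%:R : R) @[n --> \oo] --> (0 : R).
Proof.
rewrite -(mulr0 m%:R); apply: cvgMl_tmp.
have H : \forall n \near \oo, 0 < (n%:R : R).
  by near=> n; rewrite ltr0n; near: n; exact: nbhs_infty_gt.
by have /(_ _)/iffRL := gtr0_cvgV0 H; apply => //; exact: cvgr_idn.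
Unshelve. all: by end_near. Qed.

Lemma near_div_nat_gt0 m : (0 < m)%N -> \forall n \near \oo, 0 < (m%:R / n%:R : R).
Proof.
move=> m0; near=> n; rewrite divr_gt0 ?ltr0n //.
by near: n; exact: nbhs_infty_gt.
Unshelve. all: by end_near. Qed.

Lemma cvg_ln_natV : (ln (n%:R : R))^-1 @[n --> \oo] --> (0 : R).
Proof.
have := cvg_lnV_t (near_div_nat_gt0 (ltn0Sn 0)) (@cvg_div_nat 1).
by under eq_fun do rewrite div1r invrK.
Qed.

(** Factors the constant of [comb_gf_asymp] as the claimed constant times the Gaussian one, the form
    [kappa * g] used by [karamata_squares]. *)
Lemma sqrt_pi_constants : (Num.sqrt 8)^-1 / 2 =
  1 / (2 * Num.sqrt (2 * pi)) * (Num.sqrt pi / 2) :> R.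
Proof.
have p0 : 0 < Num.sqrt pi :> R by rewrite sqrtr_gt0 pi_gt0.
have s2 : 0 < Num.sqrt 2 :> R by rewrite sqrtr_gt0.
have -> : 8 = 2 ^+ 2 * 2 :> R by ring.
rewrite (@sqrtrM R (2 ^+ 2)) ?sqr_ge0 // sqrtr_sqr ger0_norm //.
rewrite (@sqrtrM R 2) //.
by field; rewrite !gt_eqF.
Qed.

(** Take [t = m / n]: replacing [ln (n / m)] by [ln n] costs the factor [1 - ln m / ln n], which
    tends to 1. *)
Lemma comb_gf_norm m : (0 < m)%N ->
  comb_gf (expR (- (m%:R / n%:R))) / (Num.sqrt n%:R * ln n%:R) @[n --> \oo] -->
  (1 / (2 * Num.sqrt (2 * pi)) * (Num.sqrt pi / 2 / Num.sqrt m%:R) : R).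
Proof.
move=> m0; rewrite mulrA -sqrt_pi_constants.
have A := comb_gf_asymp (near_div_nat_gt0 m0) (@cvg_div_nat m).
have B : comb_gf (expR (- (m%:R / n%:R))) * Num.sqrt (m%:R / n%:R) / ln (m%:R / n%:R)^-1
   * (1 - ln m%:R * (ln n%:R)^-1) * (Num.sqrt m%:R)^-1 @[n --> \oo] -->
   ((Num.sqrt 8)^-1 / 2 * (1 - ln m%:R * 0) * (Num.sqrt m%:R)^-1 : R).
  apply: cvgMr_tmp; apply: cvgM => //; apply: cvgB; first exact: cvg_cst.
  by apply: cvgMl_tmp; exact: cvg_ln_natV.
rewrite mulr0 subr0 mulr1 in B.
apply: cvg_trans B; apply: near_eq_cvg; near=> n.
have n1 : (1 < n)%N by near: n; exact: near_gt1.
have mn : (m < n)%N by near: n; exact: nbhs_infty_gt.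
have mR : 0 < m%:R :> R by rewrite ltr0n.
have nR : 0 < n%:R :> R by rewrite ltr0n ltnW.
have ln0 : 0 < ln n%:R :> R by rewrite ln_gt0 // ltr1n.
have lmn : 0 < ln n%:R - ln m%:R :> R by rewrite subr_gt0 ltr_ln ?posrE // ltr_nat.
rewrite invf_div ln_div ?posrE // sqrtrM ?(ltW mR) // sqrtrV ?(ltW nR) //.
have sm : 0 < Num.sqrt m%:R :> R by rewrite sqrtr_gt0.
have sn : 0 < Num.sqrt n%:R :> R by rewrite sqrtr_gt0.
by field; rewrite !gt_eqF.
Unshelve. all: by end_near. Qed.

Lemma square_gf_norm (V : R -> R) m : (0 < m)%N ->
  (forall h, 0 < h -> Num.sqrt pi / 2 <= h * V (expR (- h ^+ 2)) <= h + Num.sqrt pi / 2) ->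
  V (expR (- (m%:R / n%:R))) / Num.sqrt n%:R @[n --> \oo] -->
  (Num.sqrt pi / 2 / Num.sqrt m%:R : R).
Proof.
move=> m0 HV.
have K : Num.sqrt (m%:R / n%:R) @[n --> \oo] --> (0 : R).
  rewrite -sqrtr0; exact: (cvg_comp _ _ (@cvg_div_nat m) (@sqrt_continuous R 0)).
have L1 : cst (Num.sqrt pi / 2 : R) n @[n --> \oo] --> (Num.sqrt pi / 2 : R) by exact: cvg_cst.
have L2 : Num.sqrt (m%:R / n%:R) + Num.sqrt pi / 2 @[n --> \oo] --> (0 + Num.sqrt pi / 2 : R).
  by apply: cvgD => //; exact: cvg_cst.
rewrite add0r in L2.
have L : Num.sqrt (m%:R / n%:R) * V (expR (- (m%:R / n%:R))) @[n --> \oo] -->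
    (Num.sqrt pi / 2 : R).
  apply: (squeeze_cvgr _ L1 L2); near=> n.
  have q0 : 0 < (m%:R / n%:R : R) by near: n; exact: near_div_nat_gt0.
  have := HV (Num.sqrt (m%:R / n%:R)); rewrite sqr_sqrtr ?(ltW q0) //.
  by apply; rewrite sqrtr_gt0.
have L3 : Num.sqrt (m%:R / n%:R) * V (expR (- (m%:R / n%:R))) * (Num.sqrt m%:R)^-1
  @[n --> \oo] --> (Num.sqrt pi / 2 * (Num.sqrt m%:R)^-1 : R) by exact: cvgMr_tmp.
apply: cvg_trans L3; apply: near_eq_cvg; near=> n.
have nR : 0 < n%:R :> R by rewrite ltr0n; near: n; exact: nbhs_infty_gt.
have mR : 0 < m%:R :> R by rewrite ltr0n.
rewrite sqrtrM ?(ltW mR) // sqrtrV ?(ltW nR) //.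
have sm : 0 < Num.sqrt m%:R :> R by rewrite sqrtr_gt0.
have sn : 0 < Num.sqrt n%:R :> R by rewrite sqrtr_gt0.
by field; rewrite !gt_eqF.
Unshelve. all: by end_near. Qed.

End Normalisation.

Theorem theorem1 (R : realType) (d : measure_display) (T : measurableType d)
    (P : probability T R) (W : nat -> T -> int * int)
    (hW : simple_random_walk P comb_adj (0, 0) W) :
  exists2 eps : nat -> R,
    eps n @[n --> \oo] --> (0 : R) &
    \forall n \near \oo,
      'E_P[fun t => (visited W n t)%:R]%E =
      ((1 / (2 * Num.sqrt (2 * pi)) + eps n) * (Num.sqrt n%:R * ln n%:R))%:E.
Proof.
pose phi n : R := Num.sqrt n%:R * ln n%:R.
pose kappa : R := 1 / (2 * Num.sqrt (2 * pi)).
have phi0 : \forall n \near \oo, 0 < phi n.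
  near=> n; have n1 : (1 < n)%N by near: n; exact: near_gt1.
  by rewrite mulr_gt0 ?sqrtr_gt0 ?ltr0n ?(ltnW n1) // ln_gt0 // ltr1n.
have [V [HV1 HV2]] := square_series R.
have main : (\sum_(k < n.+1) prob P (new_at W k)) / phi n @[n --> \oo] --> kappa.
  have kappa0 : 0 <= kappa by rewrite divr_ge0 // mulr_ge0 // sqrtr_ge0.
  exact: (karamata_squares (fun k => prob_ge0 P _) phi0 (new_at_gf hW) HV1
    (@comb_gf_norm R) (fun m m0 => square_gf_norm m0 HV2) kappa0).
(* At [n = 0] and [n = 1] the normalisation [phi n] is 0, so the identity is claimed only for large
   [n]. *)
exists (fun n => (\sum_(k < n.+1) prob P (new_at W k)) / phi n - kappa).
  rewrite -[X in _ --> X](subrr kappa).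
  by apply: cvgB; [exact: main|exact: cvg_cst].
near=> n; rewrite expectation_visited // addrC subrK -/(phi n) divfK //.
by rewrite gt_eqF //; near: n.
Unshelve. all: by end_near. Qed.
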